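(* Let $N\ge 2$, $p>0$, and let $f\in C^1[0,\infty)$ be nondecreasing with $f(t)>0$ for all $t>0$; put $F(s)=\int_0^s f(t)\,dt$. Consider $$\Delta u=v^p,\qquad \Delta v=f(|\nabla u|)\qquad\text{in }\mathbb{R}^N. \tag{E}$$ (i) System (E) has positive radially symmetric solutions (defined in all of $\mathbb{R}^N$) if and only if $$\int_1^\infty\Big(\int_0^s F(t)\,dt\Big)^{-p/(2p+1)}ds=\infty.$$ (ii) Assume $f(t)=t^q$ with $q\ge 1>p$ and $pq<1$, and assume $$\frac{p(q^2-4)}{1-pq}\le 2(N-1).$$ Let $(u,v)$ be any positive radially symmetric solution of (E). Then $$\lim_{|x|\to\infty}\frac{u(x)}{|x|^{\frac{2+2p-pq}{1-pq}}}=\Big[\frac{(2+q)\big(N(1-pq)+p(2+q)\big)^{1/p}\big(N(1-pq)+q(2p+1)\big)}{(1-pq)^{\frac{2p+2-pq}{p}}(2+2p-pq)^{\frac{pq-1}{p}}}\Big]^{\frac{p}{pq-1}}$$ and $$\lim_{|x|\to\infty}\frac{v(x)}{|x|^{\frac{q+2}{1-pq}}}=\Big[\frac{(2+q)\big(N(1-pq)+p(2+q)\big)^{q}\big(N(1-pq)+q(2p+1)\big)}{(1-pq)^{2+q}}\Big]^{\frac{1}{pq-1}}.$$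
   Context: A positive radially symmetric solution of (E) is a pair of radially symmetric functions $u,v\in C^2(\mathbb{R}^N)$, positive everywhere, satisfying (E) pointwise in $\mathbb{R}^N$. *)

(* Defs.v *)
From Stdlib Require Import Reals Lra.
Open Scope R_scope.

(* Points of R^N are represented as functions nat -> R, of which only the
   coordinates 0..N-1 are used. *)
Definition Rn := nat -> R.

Fixpoint sumN (n : nat) (a : nat -> R) : R :=
  match n with O => 0 | S m => sumN m a + a m end.

Definition normN (N : nat) (x : Rn) : R := sqrt (sumN N (fun i => x i * x i)).

Definition upd (x : Rn) (i : nat) (t : R) : Rn :=
  fun j => if Nat.eqb j i then t else x j.

Definition has_partial (w : Rn -> R) (i : nat) (x : Rn) (l : R) : Prop :=
  derivable_pt_lim (fun t => w (upd x i t)) (x i) l.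

Definition contN (N : nat) (w : Rn -> R) : Prop :=
  forall x eps, 0 < eps -> exists delta, 0 < delta /\
    forall y, normN N (fun i => y i - x i) < delta -> Rabs (w y - w x) < eps.

Definition C2_data (N : nat) (w : Rn -> R) (d1 : nat -> Rn -> R)
    (d2 : nat -> nat -> Rn -> R) : Prop :=
  contN N w /\
  (forall i, (i < N)%nat -> contN N (d1 i) /\
     forall x, has_partial w i x (d1 i x)) /\
  (forall i j, (i < N)%nat -> (j < N)%nat -> contN N (d2 i j) /\
     forall x, has_partial (d1 i) j x (d2 i j x)).

Definition radial (N : nat) (w : Rn -> R) : Prop :=
  exists g : R -> R, forall x, w x = g (normN N x).

Definition pos_radial_solution (N : nat) (p : R) (f : R -> R)
    (u v : Rn -> R) : Prop :=
  radial N u /\ radial N v /\ (forall x, 0 < u x /\ 0 < v x) /\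
  exists du d2u dv d2v,
    C2_data N u du d2u /\ C2_data N v dv d2v /\
    forall x,
      sumN N (fun i => d2u i i x) = Rpower (v x) p /\
      sumN N (fun i => d2v i i x) =
        f (sqrt (sumN N (fun i => du i x * du i x))).

Definition C1_nonneg (f : R -> R) : Prop :=
  exists f' : R -> R,
    (forall t, 0 < t -> derivable_pt_lim f t (f' t)) /\
    (forall eps, 0 < eps -> exists delta, 0 < delta /\
       forall h, 0 < h < delta -> Rabs ((f h - f 0) / h - f' 0) < eps) /\
    (forall t eps, 0 <= t -> 0 < eps -> exists delta, 0 < delta /\
       forall s, 0 <= s -> Rabs (s - t) < delta -> Rabs (f' s - f' t) < eps).

Definition is_integral (g : R -> R) (a b I : R) : Prop :=
  exists pr : Riemann_integrable g a b, RiemannInt pr = I.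

(* int_a^infinity g = +infinity (g nonnegative in our use) *)
Definition integral_diverges (g : R -> R) (a : R) : Prop :=
  forall M, exists S I, a <= S /\ is_integral g a S I /\ M < I.

Definition powR (t q : R) : R := if Rlt_dec 0 t then Rpower t q else 0.

Definition lim_at_infty_ratio (N : nat) (w : Rn -> R) (a L : R) : Prop :=
  forall eps, 0 < eps -> exists R0, forall x,
    R0 < normN N x -> Rabs (w x / Rpower (normN N x) a - L) < eps.

(* Main.v *)
(* Write w = u', so that (r^(N-1) w)' = r^(N-1) v^p and
   (r^(N-1) v')' = r^(N-1) f(w).

   (i) Monotonicity gives v^p / N <= w' <= v^p and f(w) / N <= v'' <= f(w). Up
   to constants, (v' v^p)' is then comparable to F(w)' and (v^(2p+1))' to G(w)',
   where G is the double primitive of f; hence w' is comparable to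
   G(w)^(p/(2p+1)), which is compatible with a global solution exactly when the
   integral diverges. For existence, the integral equation v = T v is monotone and
   the same estimate bounds all v with v <= T v, so Tarski's fixed point argument
   applies.

   (ii) For f(t) = t^q the system is monotone and homogeneous of degree pq < 1,
   so sub- and supersolutions are ordered as soon as their values at 0 are. The
   power solution v* = B r^b vanishes at 0 and is a subsolution; its translate
   v*(r + s) is a supersolution, above v at 0 for s large. Hence
   v*(r) <= v(r) <= v*(r + s), and likewise for w. *)
Require Import Defs.
From Stdlib Require Import Reals Lra Lia FunctionalExtensionality.
From Coquelicot Require Import Coquelicot.
Open Scope R_scope.

(** * Calculus *)

(** Existence has two obstacles: the coefficient [(N-1)/r] is singular at the origin, and a local
    solution need not continue. Tarski's argument works on the whole half-line at once and avoids
    both, but it needs a bound for every [v <= T v], not just for solutions. The energy estimate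
    supplies it because it uses inequalities only: if [v <= T v], monotonicity bounds the source
    [f(w)] of [T v] by [f] of the flux that [T v] itself generates, so [T v] together with that flux
    satisfies the differential inequalities of a solution.

    The exponent [p/(2p+1)] arises by eliminating [v]: integration bounds [v^(2p+1)] by [G(w)],
    while [w'] is comparable to [v^p].

    In (ii) the uniqueness theory of differential equations is of no help: [v*] vanishes at 0, where
    [v^p] with [p < 1] is not Lipschitz. Ordering comes from homogeneity instead, starting from some
    finite ratio of the two functions; the upper function must therefore be bounded away from 0,
    which the translation of [v*] achieves. *)

Lemma cont_mult (f g : R -> R) x :
  continuous f x -> continuous g x -> continuous (fun y => f y * g y) x.
Proof. exact (continuous_mult f g x). Qed.

Lemma cont_plus (f g : R -> R) x :
  continuous f x -> continuous g x -> continuous (fun y => f y + g y) x.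
Proof. exact (continuous_plus f g x). Qed.

Lemma cont_opp (f : R -> R) x :
  continuous f x -> continuous (fun y => - f y) x.
Proof. exact (continuous_opp f x). Qed.

Lemma cont_minus (f g : R -> R) x :
  continuous f x -> continuous g x -> continuous (fun y => f y - g y) x.
Proof. exact (continuous_minus f g x). Qed.

Lemma cont_comp (f g : R -> R) x :
  continuous g x -> continuous f (g x) -> continuous (fun y => f (g y)) x.
Proof. exact (continuous_comp g f x). Qed.

Lemma cont_pow (f : R -> R) m x :
  continuous f x -> continuous (fun y => f y ^ m) x.
Proof.
  intros Hf. induction m as [|m IH]; simpl.
  - apply continuous_const.
  - now apply cont_mult.
Qed.

Lemma derive_cont (f : R -> R) x l : is_derive f x l -> continuous f x.
Proof.
  intros H. apply (ex_derive_continuous (K := R_AbsRing) (V := R_NormedModule)).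
  now exists l.
Qed.

Ltac cont := repeat match goal with
  | |- continuous (fun _ => ?c) _ => apply continuous_const
  | |- continuous (fun y => y) _ => apply continuous_id
  | |- continuous (fun y => @?f y + @?g y) _ => apply (cont_plus f g)
  | |- continuous (fun y => @?f y - @?g y) _ => apply (cont_minus f g)
  | |- continuous (fun y => - @?f y) _ => apply (cont_opp f)
  | |- continuous (fun y => @?f y * @?g y) _ => apply (cont_mult f g)
  | |- continuous (fun y => @?f y ^ ?m) _ => apply (cont_pow f m)
  end.

Lemma cont_eps (f : R -> R) x :
  continuous f x <->
  forall eps, 0 < eps -> exists delta, 0 < delta /\
    forall y, Rabs (y - x) < delta -> Rabs (f y - f x) < eps.
Proof.
  split.
  - intros H eps He.
    destruct (proj1 (filterlim_locally _ _) H (mkposreal eps He)) as [d Hd].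
    exists d. split; [apply cond_pos|]. intros y Hy. now apply Hd.
  - intros H. apply filterlim_locally. intros eps.
    destruct (H eps (cond_pos eps)) as [d [Hd Hy]].
    exists (mkposreal d Hd). intros y Hb. now apply Hy.
Qed.

Lemma nondecr_of_derive (g dg : R -> R) a b :
  a <= b -> (forall x, a <= x <= b -> continuous g x) ->
  (forall x, a < x < b -> is_derive g x (dg x)) ->
  (forall x, a < x < b -> 0 <= dg x) -> g a <= g b.
Proof.
  intros Hab Hc Hd Hp.
  (* [MVT_gen] may return an endpoint, where the sign of [dg] is unknown; [dg'] is set to 0
     there. *)
  set (dg' := fun x => if Rlt_dec a x then if Rlt_dec x b then dg x else 0 else 0).
  destruct (MVT_gen g a b dg') as [c [_ Hc2]].
  - rewrite Rmin_left, Rmax_right by lra. intros x Hx. unfold dg'.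
    destruct (Rlt_dec a x); [|lra]. destruct (Rlt_dec x b); [|lra]. now apply Hd.
  - rewrite Rmin_left, Rmax_right by lra. intros x Hx.
    apply continuity_pt_filterlim. now apply Hc.
  - assert (0 <= dg' c).
    { unfold dg'. destruct (Rlt_dec a c); [|lra]. destruct (Rlt_dec c b); [|lra].
      now apply Hp. }
    nra.
Qed.

Lemma nondecr_of_derive_all (g dg : R -> R) a b :
  a <= b -> (forall x, a <= x <= b -> is_derive g x (dg x)) ->
  (forall x, a < x < b -> 0 <= dg x) -> g a <= g b.
Proof.
  intros Hab Hd Hp. apply (nondecr_of_derive g dg); trivial.
  - intros x Hx. now apply (derive_cont g x (dg x)), Hd.
  - intros x Hx. apply Hd. lra.
Qed.

Lemma is_derive_Rmult (f g : R -> R) (x df dg : R) :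
  is_derive f x df -> is_derive g x dg ->
  is_derive (fun y => f y * g y) x (df * g x + f x * dg).
Proof.
  intros Hf Hg. apply (is_derive_mult f g x df dg Hf Hg). intros; apply Rmult_comm.
Qed.

Lemma is_derive_Rcomp (f g : R -> R) (x df dg : R) :
  is_derive f (g x) df -> is_derive g x dg ->
  is_derive (fun y => f (g y)) x (dg * df).
Proof. exact (is_derive_comp f g x df dg). Qed.

Lemma is_derive_Rpow n x : is_derive (fun y : R => y ^ n) x (INR n * x ^ pred n).
Proof. apply is_derive_Reals, derivable_pt_lim_pow. Qed.

Lemma is_derive_Rpower a x :
  0 < x -> is_derive (fun y => Rpower y a) x (a * Rpower x (a - 1)).
Proof. intros Hx. apply is_derive_Reals. now apply derivable_pt_lim_power. Qed.

Lemma is_derive_eq (f : R -> R) (x l l' : R) : is_derive f x l -> l = l' -> is_derive f x l'.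
Proof. now intros H <-. Qed.

Lemma is_derive_Rid x : is_derive (fun y : R => y) x 1.
Proof. exact (is_derive_id x). Qed.

Lemma is_derive_Rplus (f g : R -> R) (x df dg : R) :
  is_derive f x df -> is_derive g x dg -> is_derive (fun y => f y + g y) x (df + dg).
Proof. exact (is_derive_plus f g x df dg). Qed.

Lemma is_derive_Rminus (f g : R -> R) (x df dg : R) :
  is_derive f x df -> is_derive g x dg -> is_derive (fun y => f y - g y) x (df - dg).
Proof. exact (is_derive_minus f g x df dg). Qed.

Lemma is_derive_Rscal (f : R -> R) (c x df : R) :
  is_derive f x df -> is_derive (fun y => c * f y) x (c * df).
Proof. exact (is_derive_scal f x c df). Qed.

(** [r ^ m] is the integrating factor of [w' + (m/r) w]. When [w] is the slope of a radial profile,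
    this expression is its Laplacian in dimension [m + 1]. *)
Lemma is_derive_weight m (w : R -> R) dw r :
  0 < r -> is_derive w r dw ->
  is_derive (fun s => s ^ m * w s) r (r ^ m * (dw + INR m / r * w r)).
Proof.
  intros Hr Hw. eapply is_derive_eq.
  - apply is_derive_Rmult; [apply is_derive_Rpow | exact Hw].
  - destruct m as [|m]; simpl pred.
    + simpl. field. lra.
    + change (r ^ S m) with (r * r ^ m). field. lra.
Qed.

(* Compare [r^m w] with [r^(m+1) k(b) / (m+1)]. *)
Lemma flux_bounds m (w dw k : R -> R) b :
  0 < b -> (forall r, 0 <= r <= b -> continuous w r) -> w 0 = 0 ->
  (forall r, 0 < r <= b -> is_derive w r (dw r)) ->
  (forall r, 0 < r <= b -> dw r + INR m / r * w r = k r) ->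
  (forall r, 0 < r <= b -> 0 <= k r <= k b) ->
  0 <= w b /\ k b / (INR m + 1) <= dw b <= k b.
Proof.
  intros Hb Hc H0 Hd He Hk.
  assert (Hm := pos_INR m).
  assert (Hbm : 0 < b ^ m) by now apply pow_lt.
  assert (H1 : 0 ^ m * w 0 <= b ^ m * w b).
  { apply (nondecr_of_derive (fun s => s ^ m * w s) (fun r => r ^ m * k r)).
    - lra.
    - intros x Hx. apply cont_mult; [apply cont_pow, continuous_id | now apply Hc].
    - intros x Hx. rewrite <- He by lra. apply is_derive_weight; [lra | apply Hd; lra].
    - intros x Hx. apply Rmult_le_pos; [apply pow_le; lra | apply Hk; lra]. }
  rewrite H0, Rmult_0_r in H1.
  assert (Hw : 0 <= w b) by nra.
  assert (H2 : k b / (INR m + 1) * 0 ^ S m - 0 ^ m * w 0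
               <= k b / (INR m + 1) * b ^ S m - b ^ m * w b).
  { apply (nondecr_of_derive (fun s => k b / (INR m + 1) * s ^ S m - s ^ m * w s)
       (fun r => r ^ m * (k b - k r))).
    - lra.
    - intros x Hx. cont. now apply Hc.
    - intros x Hx. eapply is_derive_eq.
      + apply is_derive_Rminus.
        * apply is_derive_Rscal, is_derive_Rpow.
        * apply is_derive_weight; [lra | apply Hd; lra].
      + rewrite He by lra. simpl pred. rewrite S_INR. field. lra.
    - intros x Hx. apply Rmult_le_pos; [apply pow_le; lra |].
      assert (Hkx := Hk x ltac:(lra)). lra. }
  rewrite H0, Rmult_0_r in H2. simpl pow in H2.
  assert (H3 : w b <= b * (k b / (INR m + 1))).
  { apply (Rmult_le_reg_l (b ^ m)); [trivial|]. nra. }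
  assert (H4 := He b ltac:(lra)).
  assert (H5 : 0 <= INR m / b) by (apply Rdiv_le_0_compat; lra).
  split; [trivial|]. split; [|nra].
  (* The damping term uses up at most the fraction [m/(m+1)] of [k b], which leaves [k b / (m+1)]
     for [dw b]. *)
  assert (H6 : INR m / b * w b <= INR m / b * (b * (k b / (INR m + 1))))
    by now apply Rmult_le_compat_l.
  replace (INR m / b * (b * (k b / (INR m + 1)))) with (k b - k b / (INR m + 1)) in H6
    by (field; lra).
  lra.
Qed.

(** * Radial solutions of the Poisson equation *)

(** At [s = r^2] this is [r^(-m-1)] times the integral of [t^m k(t)] over [[0, r]]; rescaling to
    [[0, 1]] removes the singularity at [r = 0]. Since [sqrt] is 0 on nonpositive arguments, the
    mean extends to [s <= 0] as a constant. *)
Definition mean (m : nat) (k : R -> R) (s : R) : R :=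
  RInt (fun t => t ^ m * k (sqrt s * t)) 0 1.

(* The radial function on R^(m+1) with Laplacian [k] and value [c] at the
   origin; integrating in the variable [r^2] makes it smooth at [r = 0]. *)
Definition lift (m : nat) (c : R) (k : R -> R) (r : R) : R :=
  c + RInt (mean m k) 0 (r ^ 2) / 2.

(** The solution of [w' + (m/r) w = k] vanishing at 0, extended oddly to [r < 0]. It is the
    derivative of [lift], including at [r = 0]. *)
Definition flux (m : nat) (k : R -> R) (r : R) : R := r * mean m k (r ^ 2).

Lemma cont_ex_RInt (f : R -> R) a b : (forall x, continuous f x) -> ex_RInt f a b.
Proof. intros H. apply (ex_RInt_continuous (V := R_CompleteNormedModule)). intros; apply H. Qed.

Lemma is_derive_RInt_cont (f : R -> R) a x :
  (forall y, continuous f y) -> is_derive (fun y => RInt f a y) x (f x).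
Proof.
  intros H. apply (is_derive_RInt f _ a x); [|apply H].
  apply filter_forall. intros y. apply (RInt_correct (V := R_CompleteNormedModule)).
  now apply cont_ex_RInt.
Qed.

Lemma cont_weight m (k : R -> R) c :
  (forall x, continuous k x) -> forall x, continuous (fun t => t ^ m * k (c * t)) x.
Proof.
  intros Hk x. cont. apply (cont_comp k (fun t => c * t)); [cont | apply Hk].
Qed.

Lemma mean_const m c s : mean m (fun _ => c) s = c / (INR m + 1).
Proof.
  assert (Hm := pos_INR m).
  unfold mean. apply is_RInt_unique.
  replace (c / (INR m + 1)) with
    (minus (c / (INR m + 1) * 1 ^ S m) (c / (INR m + 1) * 0 ^ S m)).
  - apply (is_RInt_derive (fun t => c / (INR m + 1) * t ^ S m)).
    + intros x _. eapply is_derive_eq; [apply is_derive_Rscal, is_derive_Rpow|].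
      simpl pred. rewrite S_INR. field. lra.
    + intros x _. cont.
  - unfold minus, plus, opp; simpl. rewrite pow1. ring.
Qed.

Lemma mean_le m k1 k2 s :
  (forall x, continuous k1 x) -> (forall x, continuous k2 x) ->
  (forall x, 0 <= x <= sqrt s -> k1 x <= k2 x) -> mean m k1 s <= mean m k2 s.
Proof.
  intros H1 H2 H. unfold mean. assert (Hs := sqrt_pos s). apply RInt_le.
  - lra.
  - now apply cont_ex_RInt, cont_weight.
  - now apply cont_ex_RInt, cont_weight.
  - intros x Hx. apply Rmult_le_compat_l; [apply pow_le; lra|]. apply H. nra.
Qed.

Lemma mean_0 m k s : s <= 0 -> mean m k s = k 0 / (INR m + 1).
Proof.
  intros Hs. rewrite <- (mean_const m (k 0) s). unfold mean.
  apply RInt_ext. intros x _. now rewrite sqrt_neg_0, Rmult_0_l.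
Qed.

Lemma mean_RInt m k r :
  (forall x, continuous k x) -> 0 < r ->
  mean m k (r ^ 2) = RInt (fun s => s ^ m * k s) 0 r / r ^ S m.
Proof.
  intros Hk Hr. assert (Hp : 0 < r ^ S m) by now apply pow_lt.
  assert (Hkm : forall x, continuous (fun s => s ^ m * k s) x)
    by (intros x; cont; apply Hk).
  assert (H := RInt_comp_lin (V := R_CompleteNormedModule) (fun s => s ^ m * k s) r 0 0 1
    (cont_ex_RInt _ _ _ Hkm)).
  replace (r * 0 + 0) with 0 in H by ring. replace (r * 1 + 0) with r in H by ring.
  enough (H2 : RInt (fun s => s ^ m * k s) 0 r = r ^ S m * mean m k (r ^ 2))
    by (rewrite H2; field; lra).
  rewrite <- H. unfold mean. rewrite sqrt_pow2 by lra.
  rewrite <- (RInt_scal (V := R_CompleteNormedModule) _ 0 1 (r ^ S m))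
    by now apply cont_ex_RInt, cont_weight.
  apply RInt_ext. intros t _. rewrite Rplus_0_r, Rpow_mult_distr.
  change (r * (r ^ m * t ^ m * k (r * t)) = r * r ^ m * (t ^ m * k (r * t))). ring.
Qed.

(** Differentiating under the integral sign would require a derivative of [k]. Away from 0 the mean
    is a primitive divided by a power, so continuity of [k] is enough. *)
Lemma is_derive_mean m k s :
  (forall x, continuous k x) -> 0 < s ->
  is_derive (mean m k) s ((k (sqrt s) - (INR m + 1) * mean m k s) / (2 * s)).
Proof.
  intros Hk Hs. assert (Hr := sqrt_lt_R0 s Hs).
  assert (Hp : 0 < sqrt s ^ m) by now apply pow_lt.
  assert (Hkm : forall x, continuous (fun s => s ^ m * k s) x)
    by (intros x; cont; apply Hk).
  apply (is_derive_ext_loc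
    (fun s => (fun r => RInt (fun s => s ^ m * k s) 0 r / r ^ S m) (sqrt s))).
  - exists (mkposreal s Hs). intros y Hy.
    assert (0 < y).
    { unfold ball in Hy; simpl in Hy; unfold AbsRing_ball, minus, plus, opp, abs in Hy;
      simpl in Hy. apply Rabs_def2 in Hy. lra. }
    rewrite <- mean_RInt; [|trivial|now apply sqrt_lt_R0]. now rewrite pow2_sqrt by lra.
  - eapply is_derive_eq.
    + apply (is_derive_Rcomp (fun r => RInt (fun s => s ^ m * k s) 0 r / r ^ S m) sqrt).
      * apply (is_derive_div (fun r => RInt (fun s => s ^ m * k s) 0 r)
          (fun r => r ^ S m)).
        -- now apply (is_derive_RInt_cont (fun s => s ^ m * k s)).
        -- apply is_derive_Rpow.
        -- simpl. apply Rgt_not_eq. nra.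
      * apply is_derive_Reals, derivable_pt_lim_sqrt, Hs.
    + assert (HM := mean_RInt m k (sqrt s) Hk Hr). rewrite pow2_sqrt in HM by lra.
      rewrite HM. rewrite S_INR. simpl pred.
      replace (2 * s) with (2 * (sqrt s * sqrt s)) by (rewrite sqrt_sqrt; lra).
      simpl pow. field. split; lra.
Qed.

(** At [s <= 0] the mean is squeezed between the means of the constants [k 0 - eps/2] and
    [k 0 + eps/2]. The radius is [d ^ 2] because the argument is a squared radius. *)
Lemma cont_mean m k :
  (forall x, continuous k x) -> forall s, continuous (mean m k) s.
Proof.
  intros Hk s. destruct (Rlt_dec 0 s) as [Hs|Hs].
  - eapply derive_cont. now apply is_derive_mean.
  - apply cont_eps. intros eps He.
    destruct (proj1 (cont_eps k 0) (Hk 0) (eps / 2) ltac:(lra)) as [d [Hd Hk0]].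
    exists (d ^ 2). split; [nra|]. intros y Hy.
    rewrite (mean_0 m k s) by lra. apply Rabs_def2 in Hy.
    assert (Hsy : sqrt y < d).
    { destruct (Rlt_dec 0 y) as [Hy0|Hy0].
      - rewrite <- (sqrt_pow2 d) by lra. apply sqrt_lt_1; nra.
      - rewrite sqrt_neg_0; lra. }
    assert (Hb : forall x, 0 <= x <= sqrt y -> k 0 - eps / 2 <= k x <= k 0 + eps / 2).
    { intros x Hx. assert (H := Hk0 x). rewrite Rminus_0_r, Rabs_pos_eq in H by lra.
      specialize (H ltac:(lra)). apply Rabs_def2 in H. lra. }
    assert (Hm := pos_INR m).
    assert (H1 : mean m k y <= mean m (fun _ => k 0 + eps / 2) y).
    { apply mean_le; [trivial | intros; apply continuous_const | intros x Hx; apply Hb, Hx]. }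
    assert (H2 : mean m (fun _ => k 0 - eps / 2) y <= mean m k y).
    { apply mean_le; [intros; apply continuous_const | trivial | intros x Hx; apply Hb, Hx]. }
    rewrite mean_const in H1, H2.
    assert (H3 : eps / 2 / (INR m + 1) <= eps / 2).
    { apply (Rmult_le_reg_r (INR m + 1)); [lra|]. unfold Rdiv at 1.
      rewrite Rmult_assoc, Rinv_l by lra. nra. }
    replace ((k 0 + eps / 2) / (INR m + 1))
      with (k 0 / (INR m + 1) + eps / 2 / (INR m + 1)) in H1 by (field; lra).
    replace ((k 0 - eps / 2) / (INR m + 1))
      with (k 0 / (INR m + 1) - eps / 2 / (INR m + 1)) in H2 by (field; lra).
    apply Rabs_def1; lra.
Qed.

Lemma cont_flux m k :
  (forall x, continuous k x) -> forall r, continuous (flux m k) r.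
Proof.
  intros Hk r. unfold flux. cont. apply (cont_comp (mean m k) (fun y => y ^ 2)).
  - cont.
  - now apply cont_mean.
Qed.

Lemma flux_0 m k : flux m k 0 = 0.
Proof. unfold flux. ring. Qed.

Lemma is_derive_sq r : is_derive (fun y => y ^ 2) r (2 * r).
Proof.
  eapply is_derive_eq; [apply is_derive_Rpow|]. simpl. ring.
Qed.

Lemma is_derive_flux m k r :
  (forall x, continuous k x) -> 0 < r ->
  is_derive (flux m k) r (k r - INR m / r * flux m k r).
Proof.
  intros Hk Hr. unfold flux. eapply is_derive_eq.
  - apply is_derive_Rmult; [apply is_derive_id|].
    apply (is_derive_Rcomp (mean m k) (fun y => y ^ 2)); [|apply is_derive_sq].
    apply is_derive_mean; [trivial | now apply pow_lt].
  - rewrite sqrt_pow2 by lra. unfold one; simpl. field. lra.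
Qed.

Lemma flux_le m k1 k2 r :
  (forall x, continuous k1 x) -> (forall x, continuous k2 x) -> 0 <= r ->
  (forall x, 0 <= x <= r -> k1 x <= k2 x) -> flux m k1 r <= flux m k2 r.
Proof.
  intros H1 H2 Hr H. unfold flux. apply Rmult_le_compat_l; [trivial|].
  apply mean_le; trivial. now rewrite sqrt_pow2.
Qed.

Lemma is_derive_lift m c k r :
  (forall x, continuous k x) -> is_derive (lift m c k) r (flux m k r).
Proof.
  intros Hk. unfold lift, flux. eapply is_derive_eq.
  - apply is_derive_Rplus; [apply @is_derive_const|].
    apply (is_derive_ext (fun y => / 2 * RInt (mean m k) 0 (y ^ 2))).
    { intros t. unfold Rdiv. apply Rmult_comm. }
    apply is_derive_Rscal.
    apply (is_derive_Rcomp (fun s => RInt (mean m k) 0 s) (fun y => y ^ 2)).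
    + apply is_derive_RInt_cont. now apply cont_mean.
    + apply is_derive_sq.
  - unfold zero; simpl. field.
Qed.

Lemma cont_lift m c k :
  (forall x, continuous k x) -> forall r, continuous (lift m c k) r.
Proof. intros Hk r. eapply derive_cont. now apply is_derive_lift. Qed.

Lemma lift_0 m c k : lift m c k 0 = c.
Proof.
  unfold lift. rewrite pow_i by lia. rewrite RInt_point. unfold zero; simpl. lra.
Qed.

Lemma lift_le m c k1 k2 r :
  (forall x, continuous k1 x) -> (forall x, continuous k2 x) -> 0 <= r ->
  (forall x, 0 <= x <= r -> k1 x <= k2 x) -> lift m c k1 r <= lift m c k2 r.
Proof.
  intros H1 H2 Hr H.
  assert (lift m c k2 0 - lift m c k1 0 <= lift m c k2 r - lift m c k1 r).
  { apply (nondecr_of_derive_all (fun r => lift m c k2 r - lift m c k1 r)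
      (fun r => flux m k2 r - flux m k1 r)); trivial.
    - intros x _. apply is_derive_Rminus; now apply is_derive_lift.
    - intros x Hx. assert (flux m k1 x <= flux m k2 x); [|lra].
      apply flux_le; trivial; [lra|]. intros; apply H; lra. }
  rewrite !lift_0 in H0. lra.
Qed.

Lemma lift_even m c k r : lift m c k (- r) = lift m c k r.
Proof. unfold lift. now replace ((- r) ^ 2) with (r ^ 2) by ring. Qed.

(** * A priori bounds *)

Lemma Rpower_pos x a : 0 < Rpower x a.
Proof. apply exp_pos. Qed.

Lemma Rpower_base_1 a : Rpower 1 a = 1.
Proof. unfold Rpower. now rewrite ln_1, Rmult_0_r, exp_0. Qed.

Lemma Rpower_succ x a : 0 < x -> x * Rpower x (a - 1) = Rpower x a.
Proof.
  intros Hx. rewrite <- (Rpower_1 x) at 1 by trivial. rewrite <- Rpower_plus.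
  f_equal. ring.
Qed.

Lemma cont_Rpower (g : R -> R) a x :
  continuous g x -> 0 < g x -> continuous (fun y => Rpower (g y) a) x.
Proof.
  intros Hg Hp. apply (cont_comp (fun y => Rpower y a) g); [trivial|].
  eapply derive_cont. now apply is_derive_Rpower.
Qed.

Lemma is_derive_Rpower_comp (g : R -> R) a (x dg : R) :
  0 < g x -> is_derive g x dg ->
  is_derive (fun y => Rpower (g y) a) x (a * Rpower (g x) (a - 1) * dg).
Proof.
  intros Hp Hg. eapply is_derive_eq.
  - apply (is_derive_Rcomp (fun y => Rpower y a) g); [now apply is_derive_Rpower | exact Hg].
  - ring.
Qed.

(* Since f(w) is nondecreasing, z'' <= f(w) integrates to z^2 <= 2 f(w) phi; this
   controls the term p phi^(p-1) z^2 of (z phi^p)', which is then at most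
   (1 + 2p) f(w) phi^p <= (1 + 2p) n F(w)'. *)
Lemma energy_upper (p n : R) (f F G phi z dz w dw : R -> R) b :
  0 < p -> 1 <= n ->
  (forall s t, s <= t -> f s <= f t) -> (forall s, 0 <= f s) ->
  (forall s, is_derive F s (f s)) -> (forall s, is_derive G s (F s)) ->
  F 0 = 0 -> G 0 = 0 ->
  (forall r, is_derive phi r (z r)) -> (forall r, continuous z r) ->
  (forall r, continuous w r) -> w 0 = 0 -> z 0 = 0 -> phi 0 = 1 ->
  (forall r, 0 <= r -> 0 <= z r /\ 0 <= w r /\ 1 <= phi r) ->
  (forall r, 0 < r -> is_derive z r (dz r)) ->
  (forall r, 0 < r -> is_derive w r (dw r)) ->
  (forall r, 0 < r -> dz r <= f (w r)) ->
  (forall r, 0 < r -> Rpower (phi r) p <= n * dw r) ->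
  0 <= b ->
  Rpower (phi b) (2 * p + 1) <= 1 + (2 * p + 1) ^ 2 * n ^ 2 * G (w b).
Proof.
  intros Hp Hn Hmon Hf0 HF HG HF0 HG0 Hphi Hcz Hcw Hw0 Hz0 Hphi0 Hpos Hdz Hdw Hz Hw Hb.
  assert (Hcphi : forall r, continuous phi r).
  { intros r. eapply derive_cont, Hphi. }
  assert (Hdw0 : forall r, 0 < r -> 0 <= dw r).
  { intros r Hr. assert (H1 := Hw r Hr). assert (H2 := Rpower_pos (phi r) p). nra. }
  assert (Hwm : forall r s, 0 <= r <= s -> w r <= w s).
  { intros r s Hrs. apply (nondecr_of_derive w dw); [lra|auto| |].
    - intros x Hx. apply Hdw; lra.
    - intros x Hx. apply Hdw0; lra. }
  (* The factor [f (w r)] is frozen at the right endpoint while integrating, so [f] is never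
     differentiated. *)
  assert (H1 : forall r, 0 <= r -> z r * z r <= 2 * f (w r) * phi r).
  { intros r Hr.
    assert (H : 2 * f (w r) * phi 0 - z 0 * z 0 <= 2 * f (w r) * phi r - z r * z r).
    { apply (nondecr_of_derive (fun s => 2 * f (w r) * phi s - z s * z s)
        (fun s => 2 * f (w r) * z s - (dz s * z s + z s * dz s))); [trivial| | |].
      - intros x _. cont; auto.
      - intros x Hx. apply is_derive_Rminus; [now apply is_derive_Rscal|].
        apply is_derive_Rmult; apply Hdz; lra.
      - intros x Hx. assert (Ha := Hz x ltac:(lra)).
        assert (Hc := Hmon _ _ (Hwm x r ltac:(lra))).
        destruct (Hpos x ltac:(lra)) as [Hzx _]. nra. }
    rewrite Hphi0, Hz0 in H. assert (Hfr := Hf0 (w r)). lra. }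
  assert (H2 : forall r, 0 <= r -> z r * Rpower (phi r) p <= (1 + 2 * p) * n * F (w r)).
  { intros r Hr.
    assert (H : (1 + 2 * p) * n * F (w 0) - z 0 * Rpower (phi 0) p
             <= (1 + 2 * p) * n * F (w r) - z r * Rpower (phi r) p).
    { apply (nondecr_of_derive
        (fun s => (1 + 2 * p) * n * F (w s) - z s * Rpower (phi s) p)
        (fun s => (1 + 2 * p) * n * (dw s * f (w s)) -
          (dz s * Rpower (phi s) p + z s * (p * Rpower (phi s) (p - 1) * z s))));
        [trivial| | |].
      - intros x Hx. destruct (Hpos x ltac:(lra)) as [_ [_ Hfx]]. 
        apply cont_minus; apply cont_mult; auto using continuous_const.
        + apply (cont_comp F w); [auto | eapply derive_cont, HF].
        + apply cont_Rpower; [auto | lra].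
      - intros x Hx. destruct (Hpos x ltac:(lra)) as [_ [_ Hfx]].
        apply is_derive_Rminus.
        + apply is_derive_Rscal. apply (is_derive_Rcomp F w); [apply HF | apply Hdw; lra].
        + apply (is_derive_Rmult z (fun s => Rpower (phi s) p)); [apply Hdz; lra|].
          apply is_derive_Rpower_comp; [lra | auto].
      - intros x Hx. destruct (Hpos x ltac:(lra)) as [Hzx [Hwx Hfx]].
        assert (Ha := Hz x ltac:(lra)). assert (Hc := Hw x ltac:(lra)).
        assert (Hd := H1 x ltac:(lra)). assert (Hfw := Hf0 (w x)).
        assert (HP := Rpower_pos (phi x) p). assert (HQ := Rpower_pos (phi x) (p - 1)).
        assert (HPQ := Rpower_succ (phi x) p ltac:(lra)).
        assert (Hi : z x * z x * (p * Rpower (phi x) (p - 1))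
           <= 2 * f (w x) * phi x * (p * Rpower (phi x) (p - 1))).
        { apply Rmult_le_compat_r; [nra | trivial]. }
        replace (2 * f (w x) * phi x * (p * Rpower (phi x) (p - 1)))
          with (2 * p * f (w x) * Rpower (phi x) p) in Hi by (rewrite <- HPQ; ring).
        assert (Hj : dz x * Rpower (phi x) p <= f (w x) * Rpower (phi x) p)
          by (apply Rmult_le_compat_r; lra).
        assert (Hk : (1 + 2 * p) * f (w x) * Rpower (phi x) p
          <= (1 + 2 * p) * f (w x) * (n * dw x)) by (apply Rmult_le_compat_l; nra).
        nra. }
    rewrite Hw0, HF0, Hz0 in H. lra. }
  (* Last integration: [(phi^(2p+1))' = (2p+1) phi^p (z phi^p)], and the two factors are at most
     [n w'] and [(1+2p) n F(w)]. This is the origin of the constant [(2p+1)^2 n^2]. *)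
  assert (H : (2 * p + 1) ^ 2 * n ^ 2 * G (w 0) - Rpower (phi 0) (2 * p + 1)
           <= (2 * p + 1) ^ 2 * n ^ 2 * G (w b) - Rpower (phi b) (2 * p + 1)).
  { apply (nondecr_of_derive
      (fun s => (2 * p + 1) ^ 2 * n ^ 2 * G (w s) - Rpower (phi s) (2 * p + 1))
      (fun s => (2 * p + 1) ^ 2 * n ^ 2 * (dw s * F (w s)) -
        (2 * p + 1) * Rpower (phi s) (2 * p + 1 - 1) * z s)); [trivial| | |].
    - intros x Hx. destruct (Hpos x ltac:(lra)) as [_ [_ Hfx]].
      apply cont_minus.
      + apply cont_mult; [apply continuous_const|].
        apply (cont_comp G w); [auto | eapply derive_cont, HG].
      + apply cont_Rpower; [auto | lra].
    - intros x Hx. destruct (Hpos x ltac:(lra)) as [_ [_ Hfx]].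
      apply is_derive_Rminus.
      + apply is_derive_Rscal. apply (is_derive_Rcomp G w); [apply HG | apply Hdw; lra].
      + apply is_derive_Rpower_comp; [lra | auto].
    - intros x Hx. destruct (Hpos x ltac:(lra)) as [Hzx [Hwx Hfx]].
      assert (Hc := Hw x ltac:(lra)). assert (Hd := H2 x ltac:(lra)).
      assert (HP := Rpower_pos (phi x) p). assert (Hdwx := Hdw0 x ltac:(lra)).
      replace (2 * p + 1 - 1) with (p + p) by ring. rewrite Rpower_plus.
      set (P := Rpower (phi x) p) in *.
      assert (HzP : 0 <= z x * P) by nra.
      assert (HFw : 0 <= (1 + 2 * p) * n * F (w x)) by lra.
      assert (Hi : P * (z x * P) <= n * dw x * ((1 + 2 * p) * n * F (w x)))
        by (apply Rmult_le_compat; lra).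
      assert (Hj : 0 <= (2 * p + 1) * (n * dw x * ((1 + 2 * p) * n * F (w x)) - P * (z x * P)))
        by (apply Rmult_le_pos; lra).
      nra. }
  rewrite Hw0, HG0, Hphi0, Rpower_base_1 in H. lra.
Qed.

(* A fixed point [v] of [step] is a profile of the second component with
   [v 0 = 1], and [shoot m p v] is then the derivative of the first. *)
Definition shoot (m : nat) (p : R) (phi : R -> R) (r : R) : R :=
  flux m (fun t => Rpower (phi t) p) r.

Definition step (m : nat) (p : R) (f phi : R -> R) : R -> R :=
  lift m 1 (fun r => f (shoot m p phi r)).

(** The lower bound is the value at the origin prescribed by [step]; it keeps [Rpower] on positive
    bases, where it is smooth for every exponent. *)
Definition admissible (phi : R -> R) : Prop :=
  (forall x, continuous phi x) /\ (forall x, 1 <= phi x).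

Lemma cont_power_admissible p phi x :
  admissible phi -> continuous (fun t => Rpower (phi t) p) x.
Proof. intros [Hc H1]. apply cont_Rpower; [auto | assert (H := H1 x); lra]. Qed.

Lemma cont_shoot m p phi :
  admissible phi -> forall x, continuous (shoot m p phi) x.
Proof. intros H x. apply cont_flux. intros y. now apply cont_power_admissible. Qed.

Lemma cont_f_shoot m p (f phi : R -> R) :
  (forall s, continuous f s) -> admissible phi ->
  forall x, continuous (fun r => f (shoot m p phi r)) x.
Proof. intros Hf H x. apply (cont_comp f); [now apply cont_shoot | auto]. Qed.

Lemma flux_nonneg m k r :
  (forall x, continuous k x) -> 0 <= r -> (forall x, 0 <= x <= r -> 0 <= k x) ->
  0 <= flux m k r.
Proof.
  intros Hk Hr H. assert (H0 : flux m (fun _ => 0) r <= flux m k r).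
  { apply flux_le; trivial. intros; apply continuous_const. }
  unfold flux at 1 in H0. rewrite mean_const in H0. unfold Rdiv in H0. lra.
Qed.

Lemma shoot_nonneg m p phi r : admissible phi -> 0 <= r -> 0 <= shoot m p phi r.
Proof.
  intros H Hr. apply flux_nonneg; trivial.
  - intros x. now apply cont_power_admissible.
  - intros x _. apply Rlt_le, Rpower_pos.
Qed.

Lemma shoot_le m p phi psi r :
  0 < p -> admissible phi -> admissible psi -> 0 <= r ->
  (forall x, 0 <= x <= r -> phi x <= psi x) ->
  shoot m p phi r <= shoot m p psi r.
Proof.
  intros Hp Hphi Hpsi Hr H. apply flux_le; trivial.
  - intros x. now apply cont_power_admissible.
  - intros x. now apply cont_power_admissible.
  - intros x Hx. apply Rle_Rpower_l; [lra|]. split; [|now apply H].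
    destruct Hphi as [_ H1]. assert (H2 := H1 x). lra.
Qed.

Lemma step_le m p (f phi psi : R -> R) r :
  0 < p -> (forall s, continuous f s) -> (forall s t, s <= t -> f s <= f t) ->
  admissible phi -> admissible psi -> 0 <= r ->
  (forall x, 0 <= x <= r -> phi x <= psi x) ->
  step m p f phi r <= step m p f psi r.
Proof.
  intros Hp Hf Hmon Hphi Hpsi Hr H. apply lift_le; trivial.
  - now apply cont_f_shoot.
  - now apply cont_f_shoot.
  - intros x Hx. apply Hmon, shoot_le; trivial; [lra|]. intros; apply H; lra.
Qed.

Lemma is_derive_step m p (f phi : R -> R) r :
  (forall s, continuous f s) -> admissible phi ->
  is_derive (step m p f phi) r (flux m (fun r => f (shoot m p phi r)) r).
Proof. intros. apply is_derive_lift. now apply cont_f_shoot. Qed.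

Lemma step_increasing m p (f phi : R -> R) x y :
  (forall s, continuous f s) -> (forall s, 0 <= f s) -> admissible phi ->
  0 <= x <= y -> step m p f phi x <= step m p f phi y.
Proof.
  intros Hf Hf0 Hphi Hxy.
  apply (nondecr_of_derive_all _ (flux m (fun r => f (shoot m p phi r)))).
  - lra.
  - intros z _. now apply is_derive_step.
  - intros z Hz. apply flux_nonneg; auto; [|lra]. now apply cont_f_shoot.
Qed.

Lemma step_even m p f phi r : step m p f phi (- r) = step m p f phi r.
Proof. apply lift_even. Qed.

Lemma even_Rabs (g : R -> R) x : (forall y, g (- y) = g y) -> g (Rabs x) = g x.
Proof. intros H. unfold Rabs. now destruct (Rcase_abs x). Qed.

Lemma admissible_step m p (f phi : R -> R) :
  (forall s, continuous f s) -> (forall s, 0 <= f s) -> admissible phi ->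
  admissible (step m p f phi).
Proof.
  intros Hf Hf0 Hphi. split.
  - intros x. eapply derive_cont. now apply is_derive_step.
  - intros x. rewrite <- (even_Rabs (step m p f phi)) by apply step_even.
    rewrite <- (lift_0 m 1 (fun r => f (shoot m p phi r))) at 1.
    apply step_increasing; trivial. split; [lra | apply Rabs_pos].
Qed.

(** The competitors in Tarski's argument. The inequality is asked on the half-line only, because
    [phi] need not be even although [step m p f phi] is. *)
Definition subfixed (m : nat) (p : R) (f phi : R -> R) : Prop :=
  admissible phi /\ forall r, 0 <= r -> phi r <= step m p f phi r.

(* The constant of [energy_upper] for [n = m + 1]. *)
Definition growth_const (m : nat) (p : R) : R := (2 * p + 1) ^ 2 * (INR m + 1) ^ 2.

(* The time at which the solution of w' = (1 + C G(w))^(p/(2p+1)), w(0) = 0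
   reaches [s]. *)
Definition time_of (m : nat) (p : R) (G : R -> R) (s : R) : R :=
  RInt (fun t => Rpower (1 + growth_const m p * G t) (- (p / (2 * p + 1)))) 0 s.

Lemma growth_const_pos m p : 0 < p -> 0 < growth_const m p.
Proof.
  intros Hp. assert (Hm := pos_INR m). unfold growth_const.
  apply Rmult_lt_0_compat; apply pow_lt; lra.
Qed.

Lemma primitive_sign (f F : R -> R) :
  (forall s, 0 <= f s) -> (forall s, is_derive F s (f s)) -> F 0 = 0 ->
  forall s, (0 <= s -> 0 <= F s) /\ (s <= 0 -> F s <= 0).
Proof.
  intros Hf0 HF HF0 s. split; intros Hs; rewrite <- HF0;
    apply (nondecr_of_derive_all F f); auto.
Qed.

(** Negative arguments are included so that the integrand of [time_of] is continuous on the whole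
    line. *)
Lemma double_primitive_nonneg (f F G : R -> R) :
  (forall s, 0 <= f s) -> (forall s, is_derive F s (f s)) ->
  (forall s, is_derive G s (F s)) -> F 0 = 0 -> G 0 = 0 -> forall s, 0 <= G s.
Proof.
  intros Hf0 HF HG HF0 HG0 s. destruct (Rle_dec 0 s) as [Hs|Hs].
  - rewrite <- HG0. apply (nondecr_of_derive_all G F); auto.
    intros x Hx. apply (primitive_sign f F); trivial. lra.
  - rewrite <- HG0. apply Ropp_le_cancel.
    apply (nondecr_of_derive_all (fun x => - G x) (fun x => - F x)); [lra| |].
    + intros x _. apply (is_derive_opp G), HG.
    + intros x Hx. assert (H := proj2 (primitive_sign f F Hf0 HF HF0 x)). lra.
Qed.

(** Although [phi] solves nothing, [phi1 = step phi] and [w = shoot phi1] meet the hypotheses of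
    [energy_upper]: the slope [z] of [phi1] has [z' <= f(shoot phi) <= f(w)], because [phi <= phi1].
    Hence [w' <= phi1^p <= (1 + C G(w))^(p/(2p+1))], which says that [time_of] evaluated along [w]
    grows at rate at most 1. *)
Lemma shoot_step_time m p (f F G phi : R -> R) r :
  0 < p -> (forall s, continuous f s) -> (forall s t, s <= t -> f s <= f t) ->
  (forall s, 0 <= f s) -> (forall s, is_derive F s (f s)) ->
  (forall s, is_derive G s (F s)) -> F 0 = 0 -> G 0 = 0 ->
  subfixed m p f phi -> 0 <= r ->
  time_of m p G (shoot m p (step m p f phi) r) <= r.
Proof.
  intros Hp Hf Hmon Hf0 HF HG HF0 HG0 Hphi Hr.
  assert (Hm := pos_INR m). assert (HCp := growth_const_pos m p Hp).
  assert (Ha := admissible_step m p f phi Hf Hf0 (proj1 Hphi)).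
  assert (HG1 : forall s, 1 <= 1 + growth_const m p * G s).
  { intros s. assert (H := double_primitive_nonneg f F G Hf0 HF HG HF0 HG0 s). nra. }
  set (phi1 := step m p f phi) in *. set (w := shoot m p phi1).
  set (dw := fun s => Rpower (phi1 s) p - INR m / s * w s).
  set (z := flux m (fun r => f (shoot m p phi r))).
  assert (Hcw : forall x, continuous w x) by now apply cont_shoot.
  assert (Hw0 : w 0 = 0) by apply flux_0.
  assert (Hfs := cont_f_shoot m p f phi Hf (proj1 Hphi)).
  assert (Hdw : forall s, 0 < s -> is_derive w s (dw s)).
  { intros s Hs. apply is_derive_flux; trivial. intros. now apply cont_power_admissible. }
  assert (Hwp : forall s, 0 <= s -> 0 <= w s) by (intros; now apply shoot_nonneg).
  assert (Hflux : forall s, 0 < s -> Rpower (phi1 s) p / (INR m + 1) <= dw s).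
  { intros s Hs. apply (flux_bounds m w dw (fun s => Rpower (phi1 s) p) s); trivial.
    - intros x Hx. apply Hdw. lra.
    - intros x Hx. unfold dw. ring.
    - intros x Hx. split; [apply Rlt_le, Rpower_pos|].
      apply Rle_Rpower_l; [lra|]. split.
      + destruct Ha as [_ Ha]. assert (H := Ha x). lra.
      + apply step_increasing; trivial; [apply Hphi | lra]. }
  assert (Hen : forall s, 0 <= s ->
      Rpower (phi1 s) (2 * p + 1) <= 1 + growth_const m p * G (w s)).
  { intros s Hs.
    apply (energy_upper p (INR m + 1) f F G phi1 z
      (fun r => f (shoot m p phi r) - INR m / r * z r) w dw s); trivial.
    - lra.
    - intros x. apply is_derive_step; trivial. apply Hphi.
    - intros x. now apply cont_flux.
    - apply flux_0.
    - apply lift_0.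
    - intros x Hx. split; [|split].
      + now apply flux_nonneg.
      + now apply Hwp.
      + apply Ha.
    - intros x Hx. now apply is_derive_flux.
    - intros x Hx. apply Rle_trans with (f (shoot m p phi x)).
      + assert (0 <= INR m / x * z x); [|lra].
        apply Rmult_le_pos; [apply Rdiv_le_0_compat; lra|]. apply flux_nonneg; auto; lra.
      + apply Hmon, shoot_le; trivial; [apply Hphi | lra |].
        intros y Hy. apply Hphi. lra.
    - intros x Hx. assert (H := Hflux x Hx).
      apply (Rmult_le_compat_l (INR m + 1)) in H; [|lra].
      replace ((INR m + 1) * (Rpower (phi1 x) p / (INR m + 1))) with (Rpower (phi1 x) p) in H
        by (field; lra).
      lra. }
  set (g := fun t => Rpower (1 + growth_const m p * G t) (- (p / (2 * p + 1)))).
  assert (Hg : forall x, continuous g x).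
  { intros x. apply cont_Rpower.
    - cont. eapply derive_cont, HG.
    - assert (H := HG1 x). lra. }
  assert (H : 0 - time_of m p G (w 0) <= r - time_of m p G (w r)).
  { apply (nondecr_of_derive (fun s => s - time_of m p G (w s)) (fun s => 1 - dw s * g (w s))).
    - trivial.
    - intros x _. apply cont_minus; [apply continuous_id|].
      apply (cont_comp (time_of m p G) w); [trivial|].
      eapply derive_cont. now apply (is_derive_RInt_cont g).
    - intros x Hx. apply is_derive_Rminus; [apply is_derive_Rid|].
      apply (is_derive_Rcomp (time_of m p G) w); [|apply Hdw; lra].
      now apply (is_derive_RInt_cont g).
    - intros x Hx. assert (H1 := Hen x ltac:(lra)).
      assert (Hphi1 : 1 <= phi1 x) by apply Ha.
      assert (H2 : Rpower (phi1 x) p <= Rpower (1 + growth_const m p * G (w x)) (p / (2 * p + 1))).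
      { replace p with ((2 * p + 1) * (p / (2 * p + 1))) at 1 by (field; lra).
        rewrite <- Rpower_mult. apply Rle_Rpower_l; [apply Rdiv_le_0_compat; lra|].
        split; [apply Rpower_pos | exact H1]. }
      assert (H3 : dw x <= Rpower (phi1 x) p).
      { unfold dw. assert (0 <= INR m / x * w x); [|lra].
        apply Rmult_le_pos; [apply Rdiv_le_0_compat; lra | apply Hwp; lra]. }
      unfold g. rewrite Rpower_Ropp.
      assert (HP := Rpower_pos (1 + growth_const m p * G (w x)) (p / (2 * p + 1))).
      assert (H4 : dw x * / Rpower (1 + growth_const m p * G (w x)) (p / (2 * p + 1)) <= 1).
      { apply (Rmult_le_reg_r (Rpower (1 + growth_const m p * G (w x)) (p / (2 * p + 1))));
          [trivial|]. rewrite Rmult_assoc, Rinv_l by lra. lra. }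
      lra. }
  rewrite Hw0 in H. unfold time_of at 1 in H. rewrite RInt_point in H.
  unfold zero in H; simpl in H. lra.
Qed.

(** The point is that [L] does not depend on [phi]. If [time_of] exceeds [b] at [S], then no
    [shoot m p phi] can pass [S] before radius [b], so the slope of [step m p f phi] stays below
    [b * f S] on [[0, b]]. *)
Lemma step_lipschitz m p (f F G : R -> R) b :
  0 < p -> (forall s, continuous f s) -> (forall s t, s <= t -> f s <= f t) ->
  (forall s, 0 <= f s) -> (forall s, is_derive F s (f s)) ->
  (forall s, is_derive G s (F s)) -> F 0 = 0 -> G 0 = 0 ->
  (forall M, exists S, 0 <= S /\ M < time_of m p G S) -> 0 <= b ->
  exists L, 0 <= L /\ forall phi, subfixed m p f phi -> forall x y, 0 <= x <= y -> y <= b ->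
    step m p f phi y - step m p f phi x <= L * (y - x).
Proof.
  intros Hp Hf Hmon Hf0 HF HG HF0 HG0 Hdiv Hb.
  destruct (Hdiv b) as [S [HS HSb]].
  assert (Hm := pos_INR m). assert (HCp := growth_const_pos m p Hp).
  exists (b * f S). split; [now apply Rmult_le_pos|].
  intros phi Hphi x y Hxy Hyb.
  assert (Ha1 := admissible_step m p f phi Hf Hf0 (proj1 Hphi)).
  assert (Hfs := cont_f_shoot m p f phi Hf (proj1 Hphi)).
  assert (Hw : forall s, 0 <= s <= b -> shoot m p phi s <= S).
  { intros s Hs. apply Rle_trans with (shoot m p (step m p f phi) s).
    { apply shoot_le; trivial; [apply Hphi | lra |]. intros z Hz. apply Hphi; lra. }
    assert (Ht := shoot_step_time m p f F G phi s Hp Hf Hmon Hf0 HF HG HF0 HG0 Hphi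
      ltac:(lra)).
    apply Rnot_lt_le. intros Hlt.
    assert (H : time_of m p G S <= time_of m p G (shoot m p (step m p f phi) s)); [|lra].
    apply (nondecr_of_derive_all _
      (fun t => Rpower (1 + growth_const m p * G t) (- (p / (2 * p + 1))))); [lra| |].
    - intros t _.
      apply (is_derive_RInt_cont
        (fun t => Rpower (1 + growth_const m p * G t) (- (p / (2 * p + 1))))).
      intros u. apply cont_Rpower.
      + cont. eapply derive_cont, HG.
      + assert (H := double_primitive_nonneg f F G Hf0 HF HG HF0 HG0 u). nra.
    - intros t _. apply Rlt_le, Rpower_pos. }
  assert (Hz : forall s, 0 <= s <= b ->
    flux m (fun r => f (shoot m p phi r)) s <= b * f S).
  { intros s Hs. apply Rle_trans with (flux m (fun _ => f S) s).
    - apply flux_le; trivial; [intros; apply continuous_const | lra |].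
      intros t Ht. apply Hmon, Hw. lra.
    - unfold flux. rewrite mean_const. assert (HfS := Hf0 S).
      apply Rmult_le_compat; try lra.
      + apply Rdiv_le_0_compat; lra.
      + apply (Rmult_le_reg_r (INR m + 1)); [lra|]. unfold Rdiv.
        rewrite Rmult_assoc, Rinv_l by lra. nra. }
  assert (H : b * f S * x - step m p f phi x <= b * f S * y - step m p f phi y); [|lra].
  apply (nondecr_of_derive_all (fun t => b * f S * t - step m p f phi t)
    (fun t => b * f S * 1 - flux m (fun r => f (shoot m p phi r)) t)); [lra| |].
  - intros t _. apply is_derive_Rminus.
    + apply is_derive_Rscal. apply is_derive_Rid.
    + apply is_derive_step; trivial. apply Hphi.
  - intros t Ht. assert (H := Hz t ltac:(lra)). lra.
Qed.

(* Tarski's argument: the supremum of [step phi] over all [phi <= step phi] is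
   locally Lipschitz by the a priori bound, hence itself competes. *)
Lemma step_fixpoint m p (f F G : R -> R) :
  0 < p -> (forall s, continuous f s) -> (forall s t, s <= t -> f s <= f t) ->
  (forall s, 0 <= f s) -> (forall s, is_derive F s (f s)) ->
  (forall s, is_derive G s (F s)) -> F 0 = 0 -> G 0 = 0 ->
  (forall M, exists S, 0 <= S /\ M < time_of m p G S) ->
  exists v, admissible v /\ forall r, v r = step m p f v r.
Proof.
  intros Hp Hf Hmon Hf0 HF HG HF0 HG0 Hdiv.
  assert (HL := fun b => step_lipschitz m p f F G b Hp Hf Hmon Hf0 HF HG HF0 HG0 Hdiv).
  assert (Hone : subfixed m p f (fun _ => 1)).
  { assert (Ha : admissible (fun _ => 1)).
    { split; [intros; apply continuous_const | intros; lra]. }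
    split; [trivial|]. intros r _. now apply admissible_step. }
  (* The supremum is taken over [step phi] and not over [phi]: the images are even, increasing on
     the half-line and equi-Lipschitz, whereas the [phi] are merely continuous. *)
  set (A := fun r y => exists phi, subfixed m p f phi /\ y = step m p f phi r).
  assert (Hne : forall r, exists y, A r y).
  { intros r. exists (step m p f (fun _ => 1) r), (fun _ => 1). now split. }
  assert (Hbd : forall r, bound (A r)).
  { intros r. destruct (HL (Rabs r) (Rabs_pos r)) as [L [HL0 HLr]].
    exists (1 + L * Rabs r). intros y [phi [Hphi ->]].
    rewrite <- (even_Rabs (step m p f phi)) by apply step_even.
    assert (H := HLr phi Hphi 0 (Rabs r) ltac:(split; [lra | apply Rabs_pos]) ltac:(lra)).
    unfold step at 2 in H. rewrite lift_0 in H. lra. }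
  set (v := fun r => proj1_sig (completeness (A r) (Hbd r) (Hne r))).
  assert (Hv : forall r, is_lub (A r) (v r)).
  { intros r. unfold v. now destruct (completeness (A r) (Hbd r) (Hne r)). }
  assert (Hub : forall phi r, subfixed m p f phi -> step m p f phi r <= v r).
  { intros phi r Hphi. apply (Hv r). now exists phi. }
  assert (Hle : forall r M, (forall phi, subfixed m p f phi -> step m p f phi r <= M) -> v r <= M).
  { intros r M H. apply (Hv r). intros y [phi [Hphi ->]]. auto. }
  assert (Heven : forall x, v (- x) = v x).
  { intros x. apply Rle_antisym; apply Hle; intros phi Hphi.
    - rewrite step_even. auto.
    - rewrite <- step_even. auto. }
  assert (Hinc : forall x y, 0 <= x <= y -> v x <= v y).
  { intros x y Hxy. apply Hle. intros phi Hphi.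
    apply Rle_trans with (step m p f phi y); [|auto].
    apply step_increasing; trivial. apply Hphi. }
  assert (Hlip : forall b, 0 <= b -> exists L, 0 <= L /\
    forall x y, 0 <= x <= b -> 0 <= y <= b -> Rabs (v y - v x) <= L * Rabs (y - x)).
  { intros b Hb. destruct (HL b Hb) as [L [HL0 HLb]]. exists L. split; [trivial|].
    assert (H : forall x y, 0 <= x <= y -> y <= b -> v y - v x <= L * (y - x)).
    { intros x y Hxy Hyb. enough (v y <= v x + L * (y - x)) by lra.
      apply Hle. intros phi Hphi. assert (H1 := HLb phi Hphi x y Hxy Hyb).
      assert (H2 := Hub phi x Hphi). lra. }
    intros x y Hx Hy. destruct (Rle_dec x y) as [Hxy|Hxy].
    - rewrite (Rabs_pos_eq (y - x)) by lra. rewrite Rabs_pos_eq.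
      + apply H; lra.
      + assert (H1 := Hinc x y ltac:(lra)). lra.
    - rewrite (Rabs_left1 (y - x)) by lra. rewrite Rabs_left1.
      + assert (H1 := H y x ltac:(lra) ltac:(lra)). lra.
      + assert (H1 := Hinc y x ltac:(lra)). lra. }
  assert (Ha : admissible v).
  { split.
    - intros x. destruct (Hlip (Rabs x + 1) ltac:(assert (H := Rabs_pos x); lra))
        as [L [HL0 HLx]].
      apply cont_eps. intros eps He. exists (Rmin 1 (eps / (L + 1))). split.
      { apply Rmin_pos; [lra | apply Rdiv_lt_0_compat; lra]. }
      intros y Hy.
      assert (Hy1 := Rlt_le_trans _ _ _ Hy (Rmin_l _ _)).
      assert (Hy2 := Rlt_le_trans _ _ _ Hy (Rmin_r _ _)).
      assert (Ht := Rabs_triang_inv y x).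
      rewrite <- (even_Rabs v y), <- (even_Rabs v x) by trivial.
      eapply Rle_lt_trans; [apply HLx|].
      + split; [apply Rabs_pos | lra].
      + split; [apply Rabs_pos | lra].
      + assert (H1 := Rabs_triang_inv2 y x). assert (H0 := Rabs_pos (y - x)).
        apply (Rmult_lt_compat_r (L + 1)) in Hy2; [|lra].
        replace (eps / (L + 1) * (L + 1)) with eps in Hy2 by (field; lra). nra.
    - intros x. apply Rle_trans with (step m p f (fun _ => 1) x).
      + apply admissible_step; trivial. apply Hone.
      + now apply Hub. }
  (* From [phi <= step phi <= v] follows [step phi <= step v]; then pass to the supremum. So [v] is
     itself a competitor, and [Hub] gives the reverse inequality. *)
  assert (Hvs : forall r, 0 <= r -> v r <= step m p f v r).
  { intros r Hr. apply Hle. intros phi Hphi. apply step_le; trivial; [apply Hphi|].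
    intros x Hx. apply Rle_trans with (step m p f phi x); [apply Hphi; lra | auto]. }
  assert (Hsub : subfixed m p f v) by now split.
  exists v. split; [trivial|]. intros r.
  rewrite <- (even_Rabs v r) by trivial.
  rewrite <- (even_Rabs (step m p f v) r) by apply step_even.
  apply Rle_antisym; [apply Hvs, Rabs_pos | now apply Hub].
Qed.

(** * Radial lifts as twice differentiable functions of several variables *)

Definition sqN (N : nat) (x : Defs.Rn) : R := sumN N (fun i => x i * x i).

Lemma sumN_ext n a b : (forall i, (i < n)%nat -> a i = b i) -> sumN n a = sumN n b.
Proof.
  induction n as [|n IH]; intros H; simpl; [trivial|].
  rewrite IH by (intros; apply H; lia). now rewrite H by lia.
Qed.

Lemma sumN_scal n c a : sumN n (fun i => c * a i) = c * sumN n a.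
Proof. induction n as [|n IH]; simpl; [ring | rewrite IH; ring]. Qed.

Lemma sumN_plus n a b : sumN n (fun i => a i + b i) = sumN n a + sumN n b.
Proof. induction n as [|n IH]; simpl; [ring | rewrite IH; ring]. Qed.

Lemma sumN_const n c : sumN n (fun _ => c) = INR n * c.
Proof. induction n as [|n IH]; simpl sumN; [simpl; ring | rewrite IH, S_INR; ring]. Qed.

Lemma sqN_nonneg N x : 0 <= sqN N x.
Proof. unfold sqN. induction N as [|N IH]; simpl; [lra | nra]. Qed.

Lemma normN_nonneg N x : 0 <= normN N x.
Proof. apply sqrt_pos. Qed.

Lemma normN_sq N x : normN N x ^ 2 = sqN N x.
Proof. apply pow2_sqrt, sqN_nonneg. Qed.

Lemma coord_sq_le N x i : (i < N)%nat -> x i * x i <= sqN N x.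
Proof.
  unfold sqN. induction N as [|N IH]; intros Hi; [lia|]; simpl.
  assert (H := sqN_nonneg N x). unfold sqN in H.
  destruct (Nat.eq_dec i N) as [->|Hn]; [lra|].
  assert (H1 := IH ltac:(lia)). nra.
Qed.

Lemma coord_le_norm N x i : (i < N)%nat -> Rabs (x i) <= normN N x.
Proof.
  intros Hi. rewrite <- sqrt_Rsqr_abs. apply sqrt_le_1_alt. now apply coord_sq_le.
Qed.

Lemma sqN_zero N x i : sqN N x = 0 -> (i < N)%nat -> x i = 0.
Proof. intros H Hi. assert (H1 := coord_sq_le N x i Hi). nra. Qed.

Lemma sqN_upd N x i t : (i < N)%nat -> sqN N (upd x i t) = t * t + (sqN N x - x i * x i).
Proof.
  assert (H0 : forall n, (n <= i)%nat -> sqN n (upd x i t) = sqN n x).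
  { intros n Hn. apply sumN_ext. intros j Hj. unfold upd.
    now rewrite (proj2 (Nat.eqb_neq j i)) by lia. }
  unfold sqN in *. induction N as [|N IH]; intros Hi; [lia|]. simpl.
  destruct (Nat.eq_dec i N) as [->|Hn].
  - rewrite H0 by lia. unfold upd. rewrite Nat.eqb_refl. ring.
  - rewrite IH by lia. unfold upd at 1 2.
    rewrite (proj2 (Nat.eqb_neq N i)) by lia. ring.
Qed.

Lemma upd_same x i : upd x i (x i) = x.
Proof.
  apply functional_extensionality. intros j. unfold upd.
  destruct (Nat.eqb_spec j i) as [->|]; trivial.
Qed.

(** Neighbourhoods for the seminorm of the first [N] coordinates, stated as a filter so that the
    general limit theorems for sums, products and compositions apply to [contN]. *)
Definition nearN (N : nat) (x : Defs.Rn) (P : Defs.Rn -> Prop) : Prop :=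
  exists delta, 0 < delta /\ forall y, normN N (fun i => y i - x i) < delta -> P y.

Local Instance nearN_filter N x : Filter (nearN N x).
Proof.
  constructor.
  - exists 1. split; [lra | trivial].
  - intros P Q [d [Hd HP]] [e [He HQ]]. exists (Rmin d e).
    split; [now apply Rmin_pos|]. intros y Hy. split.
    + apply HP. eapply Rlt_le_trans; [exact Hy | apply Rmin_l].
    + apply HQ. eapply Rlt_le_trans; [exact Hy | apply Rmin_r].
  - intros P Q H [d [Hd HP]]. exists d. split; auto.
Qed.

Definition contN_at (N : nat) (w : Defs.Rn -> R) (x : Defs.Rn) : Prop :=
  filterlim w (nearN N x) (locally (w x)).

Lemma contN_iff N w : contN N w <-> forall x, contN_at N w x.
Proof.
  split.
  - intros H x. apply filterlim_locally. intros eps.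
    exact (H x eps (cond_pos eps)).
  - intros H x eps He.
    exact (proj1 (filterlim_locally _ _) (H x) (mkposreal eps He)).
Qed.

Lemma contN_at_plus N v w x :
  contN_at N v x -> contN_at N w x -> contN_at N (fun y => v y + w y) x.
Proof.
  intros Hv Hw. exact (filterlim_comp_2 _ _ _ Hv Hw (filterlim_plus (v x) (w x))).
Qed.

Lemma contN_at_mult N v w x :
  contN_at N v x -> contN_at N w x -> contN_at N (fun y => v y * w y) x.
Proof.
  intros Hv Hw. exact (filterlim_comp_2 _ _ _ Hv Hw (filterlim_mult (v x) (w x))).
Qed.

Lemma contN_at_comp N (g : R -> R) w x :
  continuous g (w x) -> contN_at N w x -> contN_at N (fun y => g (w y)) x.
Proof. intros Hg Hw. exact (filterlim_comp _ _ _ _ _ _ _ _ Hw Hg). Qed.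

Lemma contN_at_const N c x : contN_at N (fun _ => c) x.
Proof. apply filterlim_const. Qed.

Lemma contN_at_coord N i x : (i < N)%nat -> contN_at N (fun y => y i) x.
Proof.
  intros Hi. apply filterlim_locally. intros eps. exists eps.
  split; [apply cond_pos|]. intros y Hy.
  eapply Rle_lt_trans; [|exact Hy].
  exact (coord_le_norm N (fun j => y j - x j) i Hi).
Qed.

Lemma contN_at_sqN N x : contN_at N (sqN N) x.
Proof.
  assert (H : forall n, (n <= N)%nat -> contN_at N (sqN n) x).
  { induction n as [|n IH]; intros Hn.
    - apply (contN_at_const N 0).
    - apply (contN_at_plus N (sqN n) (fun y => y n * y n)); [apply IH; lia|].
      apply contN_at_mult; apply contN_at_coord; lia. }
  now apply H.
Qed.

Lemma contN_at_normN N x : contN_at N (normN N) x.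
Proof. apply (contN_at_comp N sqrt (sqN N)); [apply continuous_sqrt | apply contN_at_sqN]. Qed.

(** The product rule at 0 for a factor that is merely continuous: the difference quotient is [g h]
    itself. It yields second derivatives at the origin and across an axis. *)
Lemma is_derive_id_mult (g : R -> R) :
  continuous g 0 -> is_derive (fun t => g t * t) 0 (g 0).
Proof.
  intros Hg. apply is_derive_Reals. intros eps He.
  destruct (proj1 (cont_eps g 0) Hg eps He) as [d [Hd H]].
  exists (mkposreal d Hd). intros h Hh Hhd. rewrite Rplus_0_l.
  replace ((g h * h - g 0 * 0) / h - g 0) with (g h - g 0) by (field; trivial).
  apply H. now rewrite Rminus_0_r.
Qed.

Definition delta (i j : nat) : R := if Nat.eqb i j then 1 else 0.

Lemma is_derive_upd x i j t : is_derive (fun s => upd x j s i) t (delta i j).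
Proof.
  unfold upd, delta. destruct (Nat.eqb i j).
  - apply is_derive_Rid.
  - apply @is_derive_const.
Qed.

Lemma is_derive_sqN_upd N x i :
  (i < N)%nat -> is_derive (fun t => sqN N (upd x i t)) (x i) (2 * x i).
Proof.
  intros Hi. apply (is_derive_ext (fun t => t * t + (sqN N x - x i * x i))).
  { intros t. now rewrite sqN_upd. }
  eapply is_derive_eq.
  - apply is_derive_Rplus; [|apply @is_derive_const].
    apply is_derive_Rmult; apply is_derive_Rid.
  - unfold zero; simpl. ring.
Qed.

(** This is [flux * x_i / |x|] with the factor [|x|] already cancelled, so the origin needs no
    separate treatment. *)
Definition lift_d1 (m : nat) (k : R -> R) (i : nat) (x : Defs.Rn) : R :=
  mean m k (sqN (S m) x) * x i.

(* At the origin the second summand is [0 * / 0 = 0]. *)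
Definition lift_d2 (m : nat) (k : R -> R) (i j : nat) (x : Defs.Rn) : R :=
  mean m k (sqN (S m) x) * delta i j +
  (k (normN (S m) x) - (INR m + 1) * mean m k (sqN (S m) x)) *
  (x i * x j * / sqN (S m) x).

(** At the origin [x_i x_j / |x|^2] has no limit, but it is bounded by 1 and its coefficient
    [e = k - (m+1) mean] tends to 0, since the mean of [k] at 0 is [k 0 / (m+1)]. *)
Lemma contN_lift_d2 m k i j :
  (forall x, continuous k x) -> (i < S m)%nat -> (j < S m)%nat ->
  contN (S m) (lift_d2 m k i j).
Proof.
  intros Hk Hi Hj. apply contN_iff. intros x. unfold lift_d2.
  assert (Hm := pos_INR m).
  assert (Hmean : contN_at (S m) (fun y => mean m k (sqN (S m) y)) x).
  { apply contN_at_comp; [now apply cont_mean | apply contN_at_sqN]. }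
  set (e := fun y => k (normN (S m) y) - (INR m + 1) * mean m k (sqN (S m) y)).
  assert (Hec : contN_at (S m) e x).
  { unfold e, Rminus. apply contN_at_plus.
    - apply contN_at_comp; [trivial | apply contN_at_normN].
    - apply (contN_at_comp _ Ropp); [apply (cont_opp (fun y => y)), continuous_id|].
      apply contN_at_mult; [apply contN_at_const | trivial]. }
  apply contN_at_plus.
  { apply contN_at_mult; [trivial | apply contN_at_const]. }
  change (contN_at (S m) (fun y => e y * (y i * y j * / sqN (S m) y)) x).
  destruct (Req_dec (sqN (S m) x) 0) as [H0|H0].
  - assert (He0 : e x = 0).
    { unfold e, normN. fold (sqN (S m) x). rewrite H0, sqrt_0, mean_0 by lra. field. lra. }
    unfold contN_at. rewrite He0, Rmult_0_l. unfold contN_at in Hec. rewrite He0 in Hec.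
    apply filterlim_locally. intros eps.
    apply (filter_imp (fun y => ball 0 eps (e y))).
    + intros y Hy. change (Rabs (e y - 0) < eps) in Hy.
      change (Rabs (e y * (y i * y j * / sqN (S m) y) - 0) < eps).
      rewrite Rminus_0_r in *. rewrite Rabs_mult.
      assert (Hb : Rabs (y i * y j * / sqN (S m) y) <= 1).
      { destruct (Req_dec (sqN (S m) y) 0) as [Hy0|Hy0].
        - rewrite (sqN_zero _ y i Hy0 Hi), !Rmult_0_l, Rabs_R0. lra.
        - assert (Hyp := sqN_nonneg (S m) y).
          rewrite Rabs_mult, (Rabs_pos_eq (/ _)) by (apply Rlt_le, Rinv_0_lt_compat; lra).
          apply (Rmult_le_reg_r (sqN (S m) y)); [lra|].
          rewrite Rmult_assoc, Rinv_l, Rmult_1_r, Rmult_1_l by trivial.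
          assert (H1 := coord_sq_le (S m) y i Hi). assert (H2 := coord_sq_le (S m) y j Hj).
          apply Rabs_le. nra. }
      assert (Hp := Rabs_pos (e y)). nra.
    + exact (proj1 (filterlim_locally _ _) Hec eps).
  - apply contN_at_mult; [trivial|]. apply contN_at_mult.
    + apply contN_at_mult; now apply contN_at_coord.
    + apply (contN_at_comp _ Rinv); [|apply contN_at_sqN].
      eapply derive_cont. apply (is_derive_inv (fun y => y) _ 1); [apply is_derive_Rid | trivial].
Qed.

Lemma has_partial_lift_d1 m k i j x :
  (forall x, continuous k x) -> (i < S m)%nat -> (j < S m)%nat ->
  has_partial (lift_d1 m k i) j x (lift_d2 m k i j x).
Proof.
  intros Hk Hi Hj. apply is_derive_Reals. unfold lift_d1.
  assert (Hx := sqN_nonneg (S m) x).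
  destruct (Req_dec (sqN (S m) x) 0) as [H0|H0].
  - assert (Hz : forall l, (l < S m)%nat -> x l = 0) by (intros; now apply (sqN_zero (S m))).
    unfold lift_d2, delta. rewrite H0, !(Hz i Hi), !(Hz j Hj), !Rmult_0_l, Rmult_0_r, Rplus_0_r.
    unfold upd at 2. destruct (Nat.eqb_spec i j) as [->|Hij].
    + rewrite Rmult_1_r.
      apply (is_derive_ext (fun t => mean m k (t * t) * t)).
      { intros t. rewrite sqN_upd, H0, (Hz j Hj) by trivial. do 2 f_equal. ring. }
      replace (mean m k 0) with (mean m k (0 * 0)) by (f_equal; ring).
      apply (is_derive_id_mult (fun t => mean m k (t * t))).
      apply (cont_comp (mean m k)); [cont | now apply cont_mean].
    + rewrite Rmult_0_r. apply (is_derive_ext (fun _ => 0)).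
      { intros t. rewrite (Hz i Hi). symmetry. apply Rmult_0_r. }
      apply @is_derive_const.
  - eapply is_derive_eq.
    + apply (is_derive_Rmult (fun t => mean m k (sqN (S m) (upd x j t))) (fun t => upd x j t i)).
      * apply (is_derive_Rcomp (mean m k) (fun t => sqN (S m) (upd x j t))).
        -- rewrite upd_same. apply is_derive_mean; [trivial | lra].
        -- now apply is_derive_sqN_upd.
      * apply is_derive_upd.
    + rewrite upd_same. unfold lift_d2, normN. fold (sqN (S m) x). field. trivial.
Qed.

Lemma lift_C2_data m c k :
  (forall x, continuous k x) ->
  C2_data (S m) (fun x => lift m c k (normN (S m) x)) (lift_d1 m k) (lift_d2 m k).
Proof.
  intros Hk. split; [|split].
  - apply contN_iff. intros x. apply (contN_at_comp _ (lift m c k)).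
    + now apply cont_lift.
    + apply contN_at_normN.
  - intros i Hi. split.
    + apply contN_iff. intros x. apply contN_at_mult; [|now apply contN_at_coord].
      apply contN_at_comp; [now apply cont_mean | apply contN_at_sqN].
    + intros x. apply is_derive_Reals. unfold lift.
      apply (is_derive_ext
        (fun t => c + / 2 * RInt (mean m k) 0 (sqN (S m) (upd x i t)))).
      { intros t. rewrite normN_sq. unfold Rdiv. now rewrite (Rmult_comm (/ 2)). }
      eapply is_derive_eq.
      * apply is_derive_Rplus; [apply @is_derive_const|].
        apply is_derive_Rscal.
        apply (is_derive_Rcomp (fun s => RInt (mean m k) 0 s) (fun t => sqN (S m) (upd x i t))).
        -- apply is_derive_RInt_cont. now apply cont_mean.
        -- now apply is_derive_sqN_upd.
      * rewrite upd_same. unfold lift_d1, zero; simpl. field.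
  - intros i j Hi Hj. split; [now apply contN_lift_d2|].
    intros x. now apply has_partial_lift_d1.
Qed.

(** Off the origin the trace is [(m+1) q + e], which is [k] by the choice of [e]. At the origin the
    second term drops out and [(m+1) q] alone equals [k 0]. *)
Lemma lift_laplacian m k x :
  sumN (S m) (fun i => lift_d2 m k i i x) = k (normN (S m) x).
Proof.
  assert (Hm := pos_INR m).
  unfold lift_d2.
  set (q := mean m k (sqN (S m) x)).
  set (e := k (normN (S m) x) - (INR m + 1) * q).
  rewrite (sumN_ext _ _ (fun i => q + e * / sqN (S m) x * (x i * x i))).
  - rewrite sumN_plus, sumN_const, sumN_scal, S_INR. fold (sqN (S m) x).
    destruct (Req_dec (sqN (S m) x) 0) as [H0|H0].
    + rewrite H0, Rmult_0_r. unfold q, normN. fold (sqN (S m) x).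
      rewrite H0, sqrt_0, mean_0 by lra. field. lra.
    + rewrite Rmult_assoc, Rinv_l by trivial. unfold e. ring.
  - intros i _. unfold delta. rewrite Nat.eqb_refl. ring.
Qed.

Lemma lift_gradient_norm m k x :
  0 <= mean m k (sqN (S m) x) ->
  sqrt (sumN (S m) (fun i => lift_d1 m k i x * lift_d1 m k i x)) = flux m k (normN (S m) x).
Proof.
  intros Hq. unfold lift_d1, flux. rewrite normN_sq.
  set (q := mean m k (sqN (S m) x)) in *.
  rewrite (sumN_ext _ _ (fun i => q * q * (x i * x i))) by (intros; ring).
  rewrite sumN_scal, sqrt_mult_alt by nra. rewrite sqrt_square by trivial.
  apply Rmult_comm.
Qed.

Lemma solution_of_profile m p f g v :
  (forall s, continuous f s) -> (forall s, 0 <= s -> f s = g s) -> (forall s, 0 <= f s) ->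
  admissible v -> (forall r, v r = step m p f v r) ->
  exists U V, pos_radial_solution (S m) p g U V.
Proof.
  intros Hf Hg Hf0 Ha Hv.
  set (k := fun r => Rpower (v r) p). set (h := fun r => f (shoot m p v r)).
  assert (Hk : forall x, continuous k x) by (intros; now apply cont_power_admissible).
  assert (Hh : forall x, continuous h x) by now apply cont_f_shoot.
  assert (Hmean : forall s, 0 <= mean m k s).
  { intros s. replace 0 with (mean m (fun _ => 0) s) by (rewrite mean_const; unfold Rdiv; ring).
    apply mean_le; [intros; apply continuous_const | trivial |].
    intros x _. apply Rlt_le, Rpower_pos. }
  (* The system sees the first component only through its derivatives, so its value 1 at the origin
     is an arbitrary positive choice. *)
  exists (fun x => lift m 1 k (normN (S m) x)), (fun x => lift m 1 h (normN (S m) x)).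
  split; [now exists (lift m 1 k)|]. split; [now exists (lift m 1 h)|].
  assert (Hpos : forall l, (forall x, continuous l x) -> (forall x, 0 <= l x) ->
    forall r, 0 <= r -> 0 < lift m 1 l r).
  { intros l Hl Hl0 r Hr. enough (lift m 1 l 0 <= lift m 1 l r) by (rewrite lift_0 in H; lra).
    apply (nondecr_of_derive_all _ (flux m l)); [trivial| |].
    - intros x _. now apply is_derive_lift.
    - intros x Hx. apply flux_nonneg; auto. lra. }
  split.
  - intros x. split; apply Hpos; trivial; try apply normN_nonneg.
    + intros y. apply Rlt_le, Rpower_pos.
    + intros y. apply Hf0.
  - exists (lift_d1 m k), (lift_d2 m k), (lift_d1 m h), (lift_d2 m h).
    split; [now apply lift_C2_data|]. split; [now apply lift_C2_data|].
    intros x. rewrite !lift_laplacian. split.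
    + unfold k. now rewrite Hv.
    + rewrite lift_gradient_norm by apply Hmean.
      rewrite <- Hg; [reflexivity|]. apply Rmult_le_pos; [apply normN_nonneg | apply Hmean].
Qed.

(** * Reduction to an ordinary differential system *)

(** On a full line through the origin the profile is a function of all real [t], so no one-sided
    derivative occurs at 0. *)
Definition axis (t : R) : Defs.Rn := upd (fun _ => 0) 0 t.

Lemma upd_axis t s : upd (axis t) 0 s = axis s.
Proof.
  apply functional_extensionality. intros j. unfold axis, upd.
  now destruct (Nat.eqb j 0).
Qed.

Lemma axis_pos t i : (0 < i)%nat -> axis t i = 0.
Proof. intros Hi. unfold axis, upd. now rewrite (proj2 (Nat.eqb_neq i 0)) by lia. Qed.

Lemma sqN_axis m t : sqN (S m) (axis t) = t * t.
Proof.
  unfold axis. rewrite sqN_upd by lia.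
  enough (sqN (S m) (fun _ => 0) = 0) by lra.
  unfold sqN. rewrite sumN_const. ring.
Qed.

Lemma sumN_head n a : sumN (S n) a = a 0%nat + sumN n (fun i => a (S i)).
Proof.
  induction n as [|n IH]; [simpl; ring|].
  change (sumN (S n) a + a (S n) = a 0%nat + (sumN n (fun i => a (S i)) + a (S n))).
  rewrite IH. ring.
Qed.

(** The profile is even, hence [z 0 = 0]. In a direction orthogonal to the axis, [w] reads
    [phi (rho s)] with [rho s = sqrt (s^2 + r^2)]; its derivative [z(rho)/rho * s] vanishes at
    [s = 0] and has slope [z r / r] there. The [m] orthogonal directions together give the term
    [(m/r) z]. *)
Lemma radial_on_axis m w d1 d2 :
  radial (S m) w -> C2_data (S m) w d1 d2 ->
  let phi := fun t => w (axis t) in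
  let z := fun t => d1 0%nat (axis t) in
  let dz := fun t => d2 0%nat 0%nat (axis t) in
  (forall x, w x = phi (normN (S m) x)) /\
  (forall t, is_derive phi t (z t)) /\ (forall t, is_derive z t (dz t)) /\ z 0 = 0 /\
  forall r, 0 < r ->
    sumN (S m) (fun i => d2 i i (axis r)) = dz r + INR m / r * z r /\
    sqrt (sumN (S m) (fun i => d1 i (axis r) * d1 i (axis r))) = Rabs (z r).
Proof.
  intros [g Hg] [_ [H1 H2]] phi z dz.
  assert (Hphi : forall x, w x = phi (normN (S m) x)).
  { intros x. unfold phi. rewrite !Hg. f_equal. unfold normN at 2.
    fold (sqN (S m) (axis (normN (S m) x))). rewrite sqN_axis.
    symmetry. apply sqrt_square, normN_nonneg. }
  assert (Hd : forall t, is_derive phi t (z t)).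
  { intros t. assert (H := proj2 (H1 0%nat ltac:(lia)) (axis t)).
    apply is_derive_Reals in H. change (axis t 0%nat) with t in H.
    eapply is_derive_ext; [|exact H]. intros s. unfold phi. cbv beta. now rewrite upd_axis. }
  assert (Hdz : forall t, is_derive z t (dz t)).
  { intros t. assert (H := proj2 (H2 0%nat 0%nat ltac:(lia) ltac:(lia)) (axis t)).
    apply is_derive_Reals in H. change (axis t 0%nat) with t in H.
    eapply is_derive_ext; [|exact H]. intros s. unfold z. cbv beta. now rewrite upd_axis. }
  split; [trivial|]. split; [trivial|]. split; [trivial|]. split.
  { assert (Heven : forall t, phi (- t) = phi t).
    { intros t. unfold phi. rewrite !Hg. f_equal. unfold normN. f_equal.
      fold (sqN (S m) (axis (- t))). fold (sqN (S m) (axis t)). rewrite !sqN_axis. ring. }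
    assert (Hneg : is_derive phi 0 (- z 0)).
    { apply (is_derive_ext (fun t => phi (- t))); [trivial|].
      eapply is_derive_eq.
      - apply (is_derive_Rcomp phi Ropp).
        + exact (Hd (- 0)).
        + exact (is_derive_opp (fun y => y) 0 1 (is_derive_Rid 0)).
      - rewrite Ropp_0. change (- 1 * z 0 = - z 0). ring. }
    apply is_derive_unique in Hneg. assert (H0 := is_derive_unique _ _ _ (Hd 0)). lra. }
  intros r Hr.
  set (rho := fun s => sqrt (s * s + r * r)).
  assert (Hrho : forall s, 0 < rho s) by (intros s; apply sqrt_lt_R0; nra).
  assert (Hd1 : forall i s, (0 < i < S m)%nat ->
    d1 i (upd (axis r) i s) = z (rho s) * / rho s * s).
  { intros i s Hi. assert (H := proj2 (H1 i ltac:(lia)) (upd (axis r) i s)).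
    apply is_derive_Reals in H.
    assert (Hs : upd (axis r) i s i = s) by (unfold upd; now rewrite Nat.eqb_refl).
    rewrite Hs in H. apply is_derive_unique in H. rewrite <- H. apply is_derive_unique.
    apply (is_derive_ext (fun t => phi (rho t))).
    { intros t. rewrite (Hphi (upd _ i t)). unfold normN.
      fold (sqN (S m) (upd (upd (axis r) i s) i t)).
      rewrite !sqN_upd, sqN_axis, Hs, axis_pos by lia. unfold rho. do 2 f_equal. ring. }
    eapply is_derive_eq.
    - apply (is_derive_Rcomp phi rho); [exact (Hd (rho s))|].
      apply (is_derive_Rcomp sqrt (fun t => t * t + r * r)).
      + apply is_derive_Reals, derivable_pt_lim_sqrt. nra.
      + apply is_derive_Rplus; [|apply @is_derive_const].
        apply is_derive_Rmult; apply is_derive_Rid.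
    - unfold zero; simpl. fold (rho s). assert (Hs0 := Hrho s). field. lra. }
  assert (Hrho0 : rho 0 = r).
  { unfold rho. rewrite Rmult_0_l, Rplus_0_l. apply sqrt_square. lra. }
  assert (Hd1r : forall i, (0 < i < S m)%nat -> d1 i (axis r) = 0).
  { intros i Hi. rewrite <- (upd_same (axis r) i), (axis_pos r i) by lia.
    rewrite Hd1 by trivial. ring. }
  assert (Hd2r : forall i, (0 < i < S m)%nat -> d2 i i (axis r) = z r / r).
  { intros i Hi. assert (H := proj2 (H2 i i ltac:(lia) ltac:(lia)) (axis r)).
    apply is_derive_Reals in H. rewrite axis_pos in H by lia.
    apply is_derive_unique in H. rewrite <- H. apply is_derive_unique.
    apply (is_derive_ext (fun t => z (rho t) * / rho t * t)).
    { intros t. now rewrite Hd1. }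
    replace (z r / r) with (z (rho 0) * / rho 0) by now rewrite Hrho0.
    apply (is_derive_id_mult (fun t => z (rho t) * / rho t)).
    assert (Hc : continuous rho 0).
    { apply (cont_comp sqrt); [cont | apply continuous_sqrt]. }
    cont.
    - apply (cont_comp z); [trivial | eapply derive_cont, Hdz].
    - apply (cont_comp Rinv); [trivial|].
      eapply derive_cont. apply (is_derive_inv (fun y => y) _ 1); [apply is_derive_Rid|].
      assert (H0 := Hrho 0). lra. }
  split; rewrite sumN_head.
  - rewrite (sumN_ext _ _ (fun _ => z r / r)) by (intros; apply Hd2r; lia).
    rewrite sumN_const. unfold dz. field. lra.
  - rewrite (sumN_ext _ _ (fun _ => 0)) by (intros; rewrite Hd1r by lia; ring).
    rewrite sumN_const, Rmult_0_r, Rplus_0_r. apply sqrt_Rsqr_abs.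
Qed.

Lemma radial_reduction m p f U V :
  pos_radial_solution (S m) p f U V ->
  exists u w dw v z dz : R -> R,
    (forall x, U x = u (normN (S m) x)) /\ (forall x, V x = v (normN (S m) x)) /\
    (forall t, 0 < v t) /\
    (forall t, is_derive u t (w t)) /\ (forall t, is_derive w t (dw t)) /\
    (forall t, is_derive v t (z t)) /\ (forall t, is_derive z t (dz t)) /\
    w 0 = 0 /\ z 0 = 0 /\
    forall r, 0 < r -> dw r + INR m / r * w r = Rpower (v r) p /\
      dz r + INR m / r * z r = f (Rabs (w r)).
Proof.
  intros [HU [HV [Hpos [du [d2u [dv [d2v [HdU [HdV Heq]]]]]]]]].
  destruct (radial_on_axis m U du d2u HU HdU) as [Hu1 [Hu2 [Hu3 [Hu4 Hu5]]]].
  destruct (radial_on_axis m V dv d2v HV HdV) as [Hv1 [Hv2 [Hv3 [Hv4 Hv5]]]].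
  exists (fun t => U (axis t)), (fun t => du 0%nat (axis t)), (fun t => d2u 0%nat 0%nat (axis t)),
    (fun t => V (axis t)), (fun t => dv 0%nat (axis t)), (fun t => d2v 0%nat 0%nat (axis t)).
  split; [exact Hu1|]. split; [exact Hv1|]. split; [intros t; apply Hpos|].
  split; [exact Hu2|]. split; [exact Hu3|]. split; [exact Hv2|]. split; [exact Hv3|].
  split; [exact Hu4|]. split; [exact Hv4|].
  intros r Hr. destruct (Heq (axis r)) as [He1 He2].
  destruct (Hu5 r Hr) as [Hl Hn]. destruct (Hv5 r Hr) as [Hl' _].
  rewrite Hl in He1. rewrite Hl', Hn in He2. now split.
Qed.

(** A first-order maximum principle: [r^m w] is nondecreasing. Besides giving signs, it compares two
    solutions when applied to their difference. *)
Lemma weighted_nonneg m (w dw : R -> R) b :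
  0 <= b -> (forall r, 0 <= r <= b -> continuous w r) -> 0 <= w 0 ->
  (forall r, 0 < r < b -> is_derive w r (dw r)) ->
  (forall r, 0 < r < b -> 0 <= dw r + INR m / r * w r) -> 0 <= w b.
Proof.
  intros Hb Hc H0 Hd H. destruct (Rle_lt_or_eq_dec 0 b Hb) as [Hb'|<-]; [|trivial].
  assert (H1 : 0 ^ m * w 0 <= b ^ m * w b).
  { apply (nondecr_of_derive (fun s => s ^ m * w s)
      (fun r => r ^ m * (dw r + INR m / r * w r))); [trivial| | |].
    - intros x Hx. cont. now apply Hc.
    - intros x Hx. apply is_derive_weight; [lra | now apply Hd].
    - intros x Hx. apply Rmult_le_pos; [apply pow_le; lra | now apply H]. }
  assert (H2 : 0 <= 0 ^ m) by (apply pow_le; lra).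
  assert (H3 : 0 < b ^ m) by now apply pow_lt.
  apply (Rmult_le_reg_l (b ^ m)); [trivial|]. nra.
Qed.

(** * Necessity of the integral condition, and transfer of divergence to [time_of] *)

Definition profile_ode (m : nat) (p : R) (f v w dw z dz : R -> R) : Prop :=
  (forall t, 0 < v t) /\ (forall t, is_derive w t (dw t)) /\
  (forall t, is_derive v t (z t)) /\ (forall t, is_derive z t (dz t)) /\
  w 0 = 0 /\ z 0 = 0 /\
  forall r, 0 < r -> dw r + INR m / r * w r = Rpower (v r) p /\
    dz r + INR m / r * z r = f (Rabs (w r)).

Lemma profile_monotone m p f v w dw z dz :
  0 < p -> (forall s, 0 <= s -> 0 <= f s) -> profile_ode m p f v w dw z dz ->
  (forall r, 0 <= r -> 0 <= z r) /\ (forall r s, 0 <= r <= s -> v r <= v s) /\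
  (forall r, 0 <= r -> 0 <= w r) /\
  (forall r, 0 < r -> Rpower (v r) p / (INR m + 1) <= dw r <= Rpower (v r) p).
Proof.
  intros Hp Hf0 [Hv [Hw [Hvz [Hz [Hw0 [Hz0 Heq]]]]]].
  assert (Hz1 : forall r, 0 <= r -> 0 <= z r).
  { intros r Hr. apply (weighted_nonneg m z dz); trivial; [|lra|].
    - intros x _. eapply derive_cont, Hz.
    - intros x Hx. destruct (Heq x ltac:(lra)) as [_ ->]. apply Hf0, Rabs_pos. }
  assert (Hv1 : forall r s, 0 <= r <= s -> v r <= v s).
  { intros r s Hrs. apply (nondecr_of_derive_all v z); [lra|auto|].
    intros x Hx. apply Hz1. lra. }
  assert (Hfl : forall r, 0 < r ->
    0 <= w r /\ Rpower (v r) p / (INR m + 1) <= dw r <= Rpower (v r) p).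
  { intros r Hr. apply (flux_bounds m w dw (fun s => Rpower (v s) p) r); trivial.
    - intros x _. eapply derive_cont, Hw.
    - intros x Hx. apply Heq. lra.
    - intros x Hx. split; [apply Rlt_le, Rpower_pos|].
      apply Rle_Rpower_l; [lra|]. split; [apply Hv | apply Hv1; lra]. }
  split; [trivial|]. split; [trivial|]. split.
  - intros r Hr. destruct (Rle_lt_or_eq_dec 0 r Hr) as [Hr'|<-]; [now apply Hfl | lra].
  - intros r Hr. now apply Hfl.
Qed.

(** Here the term [p v^(p-1) z^2] of [(z v^p)'] has the favourable sign and is dropped: with
    [n = m + 1], [(z v^p)' >= f(w) v^p / n >= F(w)' / n]. Multiplying the integrated inequality by
    [v^p >= w'] and integrating again produces [G]. *)
Lemma energy_lower m p (f F G v w dw z dz : R -> R) r :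
  0 < p -> (forall s t, s <= t -> f s <= f t) -> (forall s, 0 <= f s) ->
  (forall s, is_derive F s (f s)) -> (forall s, is_derive G s (F s)) ->
  F 0 = 0 -> G 0 = 0 -> profile_ode m p f v w dw z dz -> 0 <= r ->
  G (w r) / (INR m + 1) <= Rpower (v r) (2 * p + 1) / (2 * p + 1).
Proof.
  intros Hp Hmon Hf0 HF HG HF0 HG0 Hode Hr.
  destruct (profile_monotone m p f v w dw z dz Hp (fun s _ => Hf0 s) Hode)
    as [Hz1 [Hv1 [Hw1 Hdw]]].
  destruct Hode as [Hv [Hw [Hvz [Hz [Hw0 [Hz0 Heq]]]]]].
  assert (Hm := pos_INR m). set (n := INR m + 1) in *.
  assert (Hn : 0 < / n) by (apply Rinv_0_lt_compat; unfold n; lra).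
  assert (Hwm : forall x y, 0 <= x <= y -> w x <= w y).
  { intros x y Hxy. apply (nondecr_of_derive_all w dw); [lra|auto|].
    intros s Hs. eapply Rle_trans; [|apply Hdw; lra].
    apply Rmult_le_pos; [apply Rlt_le, Rpower_pos | now apply Rlt_le]. }
  assert (Hdz : forall s, 0 < s -> f (w s) / n <= dz s).
  { intros s Hs. apply (flux_bounds m z dz (fun x => f (w x)) s); trivial.
    - intros x _. eapply derive_cont, Hz.
    - intros x Hx. rewrite (proj2 (Heq x ltac:(lra))). now rewrite Rabs_pos_eq by (apply Hw1; lra).
    - intros x Hx. split; [apply Hf0 | apply Hmon, Hwm; lra]. }
  assert (Hcw : forall x, continuous w x) by (intros; eapply derive_cont, Hw).
  assert (Hcv : forall x, continuous v x) by (intros; eapply derive_cont, Hvz).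
  assert (Hcz : forall x, continuous z x) by (intros; eapply derive_cont, Hz).
  assert (H1 : forall s, 0 <= s -> / n * F (w s) <= z s * Rpower (v s) p).
  { intros s Hs.
    assert (H : z 0 * Rpower (v 0) p - / n * F (w 0) <= z s * Rpower (v s) p - / n * F (w s)).
    { apply (nondecr_of_derive_all (fun s => z s * Rpower (v s) p - / n * F (w s))
        (fun s => dz s * Rpower (v s) p + z s * (p * Rpower (v s) (p - 1) * z s)
           - / n * (dw s * f (w s)))); [trivial| |].
      - intros x _. apply is_derive_Rminus.
        + apply (is_derive_Rmult z (fun s => Rpower (v s) p)); [trivial|].
          now apply is_derive_Rpower_comp.
        + apply is_derive_Rscal. now apply (is_derive_Rcomp F w).
      - intros x Hx. assert (Ha := Hdz x ltac:(lra)). destruct (Hdw x ltac:(lra)) as [_ Hb].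
        assert (HP := Rpower_pos (v x) p). assert (HQ := Rpower_pos (v x) (p - 1)).
        assert (Hfw := Hf0 (w x)). assert (Hzx := Hz1 x ltac:(lra)).
        assert (Hc : f (w x) / n * Rpower (v x) p <= dz x * Rpower (v x) p)
          by (apply Rmult_le_compat_r; lra).
        assert (Hd : / n * (dw x * f (w x)) <= / n * (Rpower (v x) p * f (w x))).
        { apply Rmult_le_compat_l; [lra|]. now apply Rmult_le_compat_r. }
        assert (0 <= z x * (p * Rpower (v x) (p - 1) * z x)).
        { apply Rmult_le_pos; [trivial|]. apply Rmult_le_pos; [|trivial]. nra. }
        unfold Rdiv in Hc. nra. }
    rewrite Hw0, HF0, Hz0 in H. lra. }
  assert (H : / (2 * p + 1) * Rpower (v 0) (2 * p + 1) - / n * G (w 0)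
           <= / (2 * p + 1) * Rpower (v r) (2 * p + 1) - / n * G (w r)).
  { apply (nondecr_of_derive_all
      (fun s => / (2 * p + 1) * Rpower (v s) (2 * p + 1) - / n * G (w s))
      (fun s => / (2 * p + 1) * ((2 * p + 1) * Rpower (v s) (2 * p + 1 - 1) * z s)
         - / n * (dw s * F (w s)))); [trivial| |].
    - intros x _. apply is_derive_Rminus.
      + apply is_derive_Rscal. now apply is_derive_Rpower_comp.
      + apply is_derive_Rscal. now apply (is_derive_Rcomp G w).
    - intros x Hx. assert (Ha := H1 x ltac:(lra)). destruct (Hdw x ltac:(lra)) as [_ Hb].
      replace (2 * p + 1 - 1) with (p + p) by ring. rewrite Rpower_plus.
      replace (/ (2 * p + 1) * ((2 * p + 1) * (Rpower (v x) p * Rpower (v x) p) * z x))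
        with (Rpower (v x) p * (z x * Rpower (v x) p)) by (field; lra).
      assert (HP := Rpower_pos (v x) p).
      assert (HFw := proj1 (primitive_sign f F Hf0 HF HF0 (w x)) (Hw1 x ltac:(lra))).
      assert (dw x * F (w x) <= Rpower (v x) p * F (w x)) by (apply Rmult_le_compat_r; lra).
      assert (Rpower (v x) p * (/ n * F (w x)) <= Rpower (v x) p * (z x * Rpower (v x) p))
        by (apply Rmult_le_compat_l; lra).
      assert (/ n * (dw x * F (w x)) <= / n * (Rpower (v x) p * F (w x)))
        by (apply Rmult_le_compat_l; lra).
      lra. }
  rewrite Hw0, HG0 in H. assert (HP := Rpower_pos (v 0) (2 * p + 1)).
  assert (Hp1 : 0 < / (2 * p + 1)) by (apply Rinv_0_lt_compat; lra).
  unfold Rdiv. nra.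
Qed.

(** The integrand is frozen below 1, which makes it continuous on the whole line although [G]
    vanishes at 0. *)
Definition tail_integrand (p : R) (G : R -> R) (s : R) : R :=
  Rpower (G (Rmax 1 s)) (- (p / (2 * p + 1))).

Lemma cont_Rmax a x : continuous (Rmax a) x.
Proof.
  apply cont_eps. intros eps He. exists eps. split; [trivial|]. intros y Hy.
  eapply Rle_lt_trans; [|exact Hy]. unfold Rmax.
  destruct (Rle_dec a y), (Rle_dec a x); unfold Rabs; repeat destruct Rcase_abs; lra.
Qed.

Lemma cont_tail_integrand p (G : R -> R) :
  (forall s, continuous G s) -> (forall s, 0 < s -> 0 < G s) ->
  forall s, continuous (tail_integrand p G) s.
Proof.
  intros HG HG0 s. apply cont_Rpower.
  - apply (cont_comp G); [apply cont_Rmax | auto].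
  - apply HG0. assert (H := Rmax_l 1 s). lra.
Qed.

(** Since [w' >= c G(w)^th], the integral of [G^(-th)] from 1 to [w r] grows at least linearly in
    [r], and a global solution lets [r] run to infinity. *)
Lemma profile_tail_diverges m p (f F G v w dw z dz : R -> R) :
  0 < p -> (forall s t, s <= t -> f s <= f t) -> (forall s, 0 <= f s) ->
  (forall s, is_derive F s (f s)) -> (forall s, is_derive G s (F s)) ->
  F 0 = 0 -> G 0 = 0 -> (forall s, 0 < s -> 0 < G s) ->
  profile_ode m p f v w dw z dz ->
  forall M, exists S, 1 <= S /\ M < RInt (tail_integrand p G) 1 S.
Proof.
  intros Hp Hmon Hf0 HF HG HF0 HG0 HGpos Hode M.
  destruct (profile_monotone m p f v w dw z dz Hp (fun s _ => Hf0 s) Hode)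
    as [Hz1 [Hv1 [Hw1 Hdw]]].
  assert (Hen := fun r => energy_lower m p f F G v w dw z dz r Hp Hmon Hf0 HF HG HF0 HG0 Hode).
  destruct Hode as [Hv [Hw [Hvz [Hz [Hw0 [Hz0 Heq]]]]]].
  assert (Hm := pos_INR m). set (n := INR m + 1) in *.
  assert (Hn1 : 0 < n) by (unfold n; lra).
  assert (Hn : 0 < / n) by now apply Rinv_0_lt_compat.
  set (th := p / (2 * p + 1)) in *.
  assert (Hth : 0 < th) by (apply Rdiv_lt_0_compat; lra).
  set (c0 := Rpower (v 0) p / n).
  assert (Hc0 : 0 < c0) by (apply Rmult_lt_0_compat; [apply Rpower_pos | trivial]).
  assert (Hlin : forall r, 0 <= r -> c0 * r <= w r).
  { intros r Hr. assert (H : w 0 - c0 * 0 <= w r - c0 * r).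
    { apply (nondecr_of_derive_all (fun s => w s - c0 * s) (fun s => dw s - c0 * 1)); [trivial| |].
      - intros x _. apply is_derive_Rminus; [trivial|]. apply is_derive_Rscal, is_derive_Rid.
      - intros x Hx. destruct (Hdw x ltac:(lra)) as [Hx1 _].
        enough (c0 <= Rpower (v x) p / n) by lra.
        apply Rmult_le_compat_r; [lra|]. apply Rle_Rpower_l; [lra|].
        split; [apply Hv | apply Hv1; lra]. }
    rewrite Hw0 in H. lra. }
  (* From [w' >= v^p / n], with [v^p] bounded below by raising [v^(2p+1) >= (2p+1) G(w) / n] to the
     power [th]. *)
  set (c := / n * Rpower ((2 * p + 1) / n) th).
  assert (Hc : 0 < c) by (apply Rmult_lt_0_compat; [trivial | apply Rpower_pos]).
  (* Beyond this radius [w >= 1], so the truncation in [tail_integrand] is inactive. *)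
  set (r1 := / c0). assert (Hr1 : 0 < r1) by now apply Rinv_0_lt_compat.
  assert (Hw1' : forall r, r1 <= r -> 1 <= w r).
  { intros r Hr. eapply Rle_trans; [|apply Hlin; lra].
    replace 1 with (c0 * r1) by (unfold r1; field; lra). apply Rmult_le_compat_l; lra. }
  assert (Hg := cont_tail_integrand p G
    ltac:(intros s; eapply derive_cont, HG) HGpos).
  set (b := r1 + (Rabs M + 1) / c).
  assert (Hb : r1 <= b).
  { unfold b. assert (0 <= (Rabs M + 1) / c); [|lra].
    apply Rdiv_le_0_compat; [|trivial]. assert (H := Rabs_pos M). lra. }
  exists (w b). split; [now apply Hw1'|].
  assert (H : RInt (tail_integrand p G) 1 (w r1) - c * r1
           <= RInt (tail_integrand p G) 1 (w b) - c * b).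
  { apply (nondecr_of_derive_all (fun s => RInt (tail_integrand p G) 1 (w s) - c * s)
      (fun s => dw s * tail_integrand p G (w s) - c * 1)); [trivial| |].
    - intros x _. apply is_derive_Rminus; [|apply is_derive_Rscal, is_derive_Rid].
      apply (is_derive_Rcomp (fun y => RInt (tail_integrand p G) 1 y) w); [|trivial].
      now apply is_derive_RInt_cont.
    - intros x Hx. assert (Hwx := Hw1' x ltac:(lra)).
      assert (HGw := HGpos (w x) ltac:(lra)).
      unfold tail_integrand. rewrite Rmax_right by lra. fold th. rewrite Rpower_Ropp.
      assert (HP := Rpower_pos (G (w x)) th).
      assert (He := Hen x ltac:(lra)).
      enough (Hle : c * Rpower (G (w x)) th <= dw x).
      { assert (c * 1 <= dw x * / Rpower (G (w x)) th); [|lra].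
        apply (Rmult_le_reg_r (Rpower (G (w x)) th)); [trivial|].
        rewrite Rmult_assoc, (Rmult_comm _ (Rpower (G (w x)) th)).
        rewrite (Rmult_assoc (dw x)), Rinv_l by lra. lra. }
      eapply Rle_trans; [|apply Hdw; lra].
      unfold c. rewrite Rmult_assoc, Rpower_mult_distr;
        [|apply Rdiv_lt_0_compat; lra | trivial].
      unfold Rdiv at 2. rewrite (Rmult_comm _ (/ n)). apply Rmult_le_compat_l; [lra|].
      replace (Rpower (v x) p) with (Rpower (Rpower (v x) (2 * p + 1)) th)
        by (rewrite Rpower_mult; f_equal; unfold th; field; lra).
      apply Rle_Rpower_l; [lra|]. split.
      + apply Rmult_lt_0_compat; [apply Rdiv_lt_0_compat; lra | trivial].
      + apply (Rmult_le_compat_l (2 * p + 1)) in He; [|lra].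
        replace ((2 * p + 1) * (Rpower (v x) (2 * p + 1) / (2 * p + 1)))
          with (Rpower (v x) (2 * p + 1)) in He by (field; lra).
        eapply Rle_trans; [|exact He]. right. field. lra. }
  assert (H0 : 0 <= RInt (tail_integrand p G) 1 (w r1)).
  { apply RInt_ge_0; [now apply Hw1', Rle_refl | now apply cont_ex_RInt |].
    intros x _. apply Rlt_le, Rpower_pos. }
  assert (Hcb : c * b = c * r1 + (Rabs M + 1)) by (unfold b; field; lra).
  assert (HM := Rle_abs M). lra.
Qed.

(** For [t >= 1] the summand 1 in [1 + C G t] is absorbed by [G t / G 1], so the two integrands are
    comparable with constant [K = 1 / G 1 + C]. *)
Lemma time_of_unbounded m p (f F G : R -> R) :
  0 < p -> (forall s, 0 <= f s) ->
  (forall s, is_derive F s (f s)) -> (forall s, is_derive G s (F s)) ->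
  F 0 = 0 -> G 0 = 0 -> (forall s, 0 < s -> 0 < G s) ->
  (forall M, exists S, 1 <= S /\ M < RInt (tail_integrand p G) 1 S) ->
  forall M, exists S, 0 <= S /\ M < time_of m p G S.
Proof.
  intros Hp Hf0 HF HG HF0 HG0 HGpos Hdiv M.
  set (C := growth_const m p). assert (HC : 0 < C) by now apply growth_const_pos.
  set (th := p / (2 * p + 1)) in *.
  assert (Hth : 0 < th) by (apply Rdiv_lt_0_compat; lra).
  assert (HG1 := HGpos 1 ltac:(lra)).
  set (K := / G 1 + C). assert (HK : 0 < K).
  { unfold K. assert (0 < / G 1) by now apply Rinv_0_lt_compat. lra. }
  set (k := Rpower K (- th)). assert (Hk : 0 < k) by apply Rpower_pos.
  destruct (Hdiv (Rabs M / k)) as [S [HS HMS]]. exists S. split; [lra|].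
  assert (HGn := double_primitive_nonneg f F G Hf0 HF HG HF0 HG0).
  set (g := fun t => Rpower (1 + C * G t) (- th)).
  assert (Hg : forall x, continuous g x).
  { intros x. apply cont_Rpower.
    - cont. eapply derive_cont, HG.
    - assert (H := HGn x). nra. }
  assert (Ht := cont_tail_integrand p G ltac:(intros s; eapply derive_cont, HG) HGpos).
  change (time_of m p G S) with (RInt g 0 S).
  rewrite <- (RInt_Chasles g 0 1 S) by now apply cont_ex_RInt.
  change (M < RInt g 0 1 + RInt g 1 S).
  assert (H0 : 0 <= RInt g 0 1).
  { apply RInt_ge_0; [lra | now apply cont_ex_RInt |]. intros x _. apply Rlt_le, Rpower_pos. }
  assert (H1 : k * RInt (tail_integrand p G) 1 S <= RInt g 1 S).
  { change (k * RInt (tail_integrand p G) 1 S)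
      with (scal k (RInt (tail_integrand p G) 1 S)).
    rewrite <- (RInt_scal (V := R_CompleteNormedModule)) by now apply cont_ex_RInt.
    apply RInt_le; [trivial | | now apply cont_ex_RInt |].
    - apply cont_ex_RInt. intros x. apply (cont_mult (fun _ => k)); [cont | trivial].
    - intros x Hx. change (k * tail_integrand p G x <= g x).
      unfold tail_integrand, g, k. fold th. rewrite Rmax_right by lra.
      assert (HGx : G 1 <= G x).
      { apply (nondecr_of_derive_all G F); [lra|auto|].
        intros y Hy. apply (primitive_sign f F); trivial. lra. }
      rewrite Rpower_mult_distr by (trivial; lra).
      rewrite !Rpower_Ropp. apply Rinv_le_contravar; [apply Rpower_pos|].
      apply Rle_Rpower_l; [lra|]. split; [nra|]. unfold K.
      assert (1 <= / G 1 * G x); [|lra].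
      apply Rle_trans with (/ G 1 * G 1); [rewrite Rinv_l; lra|].
      apply Rmult_le_compat_l; [|trivial].
      now apply Rlt_le, Rinv_0_lt_compat. }
  assert (H2 : Rabs M < k * RInt (tail_integrand p G) 1 S).
  { apply (Rmult_lt_compat_l k) in HMS; [|trivial].
    replace (k * (Rabs M / k)) with (Rabs M) in HMS by (field; lra). trivial. }
  assert (HM := Rle_abs M). lra.
Qed.

(** * Existence criterion *)

(** The estimates ask for continuity, monotonicity and sign on the whole line, while [f] is only
    controlled on the half-line; it is therefore continued by the constant [f 0]. *)
Definition clamp (f : R -> R) (t : R) : R := f (Rmax 0 t).

Lemma clamp_eq f t : 0 <= t -> clamp f t = f t.
Proof. intros Ht. unfold clamp. now rewrite Rmax_right. Qed.

Lemma cont_clamp f : C1_nonneg f -> forall t, continuous (clamp f) t.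
Proof.
  intros [f' [Hd [H0 _]]] t. destruct (Rlt_dec 0 t) as [Ht|Ht].
  - apply (cont_comp f (Rmax 0)); [apply cont_Rmax|]. rewrite Rmax_right by lra.
    eapply derive_cont. apply is_derive_Reals, Hd, Ht.
  - apply cont_eps. intros eps He.
    destruct (H0 1 Rlt_0_1) as [d [Hdp Hq]].
    (* Near 0 the one-sided difference quotient is below [c], hence [|f y - f 0| <= c y]. *)
    set (c := Rabs (f' 0) + 1). assert (Hc : 0 < c).
    { unfold c. assert (H := Rabs_pos (f' 0)). lra. }
    exists (Rmin d (eps / c)). split.
    { apply Rmin_pos; [trivial | now apply Rdiv_lt_0_compat]. }
    intros y Hy. assert (Hy1 := Rlt_le_trans _ _ _ Hy (Rmin_l _ _)).
    assert (Hy2 := Rlt_le_trans _ _ _ Hy (Rmin_r _ _)).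
    unfold clamp. rewrite (Rmax_left 0 t) by lra.
    destruct (Rlt_dec 0 y) as [Hyp|Hyp].
    + rewrite Rmax_right by lra. rewrite Rabs_pos_eq in Hy1, Hy2 by lra.
      assert (H := Hq y ltac:(lra)).
      assert (H1 : Rabs ((f y - f 0) / y) < c).
      { unfold c. assert (H2 := Rabs_triang_inv ((f y - f 0) / y) (f' 0)). lra. }
      replace (f y - f 0) with ((f y - f 0) / y * y) by (field; lra).
      rewrite Rabs_mult, (Rabs_pos_eq y) by lra.
      apply Rlt_le_trans with (c * y); [apply Rmult_lt_compat_r; lra|].
      apply Rle_trans with (c * (eps / c)); [apply Rmult_le_compat_l; lra|].
      right. field. lra.
    + rewrite Rmax_left by lra. now rewrite Rminus_diag, Rabs_R0.
Qed.

Lemma clamp_incr f :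
  (forall s t, 0 <= s <= t -> f s <= f t) -> forall s t, s <= t -> clamp f s <= clamp f t.
Proof.
  intros H s t Hst. apply H. split; [apply Rmax_l | now apply Rle_max_compat_l].
Qed.

Lemma clamp_nonneg f :
  C1_nonneg f -> (forall t, 0 < t -> 0 < f t) -> forall s, 0 <= clamp f s.
Proof.
  intros Hf Hpos s. unfold clamp.
  destruct (Rle_lt_or_eq_dec 0 (Rmax 0 s) (Rmax_l 0 s)) as [H|H].
  { now apply Rlt_le, Hpos. }
  (* The sign of [f 0] is not a hypothesis; it follows from positivity on the right and
     continuity. *)
  rewrite <- H. apply Rnot_lt_le. intros Hneg.
  destruct (proj1 (cont_eps _ 0) (cont_clamp f Hf 0) (- f 0) ltac:(lra)) as [d [Hd Hc]].
  assert (Hd2 := Hc (d / 2)). rewrite Rminus_0_r, Rabs_pos_eq in Hd2 by lra.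
  specialize (Hd2 ltac:(lra)). rewrite !clamp_eq in Hd2 by lra.
  apply Rabs_def2 in Hd2. assert (H1 := Hpos (d / 2) ltac:(lra)). lra.
Qed.

Lemma is_integral_RInt g h a b I :
  a <= b -> (forall x, a < x < b -> g x = h x) -> is_integral g a b I -> RInt h a b = I.
Proof.
  intros Hab Hgh [pr <-]. rewrite <- RInt_Reals. symmetry. apply RInt_ext.
  rewrite Rmin_left, Rmax_right by trivial. exact Hgh.
Qed.

Lemma RInt_is_integral g h a b :
  a <= b -> (forall x, a <= x <= b -> g x = h x) -> (forall x, continuous h x) ->
  is_integral g a b (RInt h a b).
Proof.
  intros Hab Hgh Hh.
  assert (He : ex_RInt g a b).
  { apply (ex_RInt_ext h); [|now apply cont_ex_RInt].
    rewrite Rmin_left, Rmax_right by trivial. intros x Hx. symmetry. apply Hgh. lra. }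
  exists (ex_RInt_Reals_0 _ _ _ He). rewrite <- RInt_Reals. apply RInt_ext.
  rewrite Rmin_left, Rmax_right by trivial. intros x Hx. apply Hgh. lra.
Qed.

Lemma integral_diverges_iff p (G G1 : R -> R) :
  (forall s, 1 <= s -> G s = G1 s) ->
  (forall s, continuous G1 s) -> (forall s, 0 < s -> 0 < G1 s) ->
  integral_diverges (fun s => Rpower (G s) (- (p / (2 * p + 1)))) 1 <->
  forall M, exists b, 1 <= b /\ M < RInt (tail_integrand p G1) 1 b.
Proof.
  intros HG Hc Hp. split.
  - intros H M. destruct (H M) as [b [I [Hb [HI HM]]]]. exists b. split; [trivial|].
    rewrite (is_integral_RInt (fun s => Rpower (G s) (- (p / (2 * p + 1))))
      (tail_integrand p G1) 1 b I); trivial.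
    intros x Hx. unfold tail_integrand. rewrite Rmax_right by lra. rewrite HG by lra. trivial.
  - intros H M. destruct (H M) as [b [Hb HM]].
    exists b, (RInt (tail_integrand p G1) 1 b). split; [trivial|]. split; [|trivial].
    apply RInt_is_integral; [trivial | | now apply cont_tail_integrand].
    intros x Hx. unfold tail_integrand. rewrite Rmax_right by lra. rewrite HG by lra. trivial.
Qed.

Lemma existence_iff (m : nat) (p : R) (f F G : R -> R) :
  0 < p -> C1_nonneg f -> (forall s t, 0 <= s <= t -> f s <= f t) ->
  (forall t, 0 < t -> 0 < f t) ->
  (forall s, 0 <= s -> is_integral f 0 s (F s)) ->
  (forall s, 0 <= s -> is_integral F 0 s (G s)) ->
  ((exists u v, pos_radial_solution (S m) p f u v) <->
   integral_diverges (fun s => Rpower (G s) (- (p / (2 * p + 1)))) 1).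
Proof.
  intros Hp HC1 Hinc Hpos HF HG.
  set (f1 := clamp f). set (F1 := fun s => RInt f1 0 s). set (G1 := fun s => RInt F1 0 s).
  assert (Hf1 : forall s, continuous f1 s) by now apply cont_clamp.
  assert (Hmon : forall s t, s <= t -> f1 s <= f1 t) by now apply clamp_incr.
  assert (Hf0 : forall s, 0 <= f1 s) by now apply clamp_nonneg.
  assert (HF1 : forall s, is_derive F1 s (f1 s)) by (intros; now apply is_derive_RInt_cont).
  assert (HG1 : forall s, is_derive G1 s (F1 s)).
  { intros. apply is_derive_RInt_cont. intros y. eapply derive_cont, HF1. }
  assert (HF10 : F1 0 = 0) by (unfold F1; rewrite RInt_point; reflexivity).
  assert (HG10 : G1 0 = 0) by (unfold G1; rewrite RInt_point; reflexivity).
  assert (HFF : forall s, 0 <= s -> F s = F1 s).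
  { intros s Hs. symmetry. apply (is_integral_RInt f); auto.
    intros x Hx. symmetry. apply clamp_eq. lra. }
  assert (HGG : forall s, 0 <= s -> G s = G1 s).
  { intros s Hs. symmetry. apply (is_integral_RInt F); auto.
    intros x Hx. apply HFF. lra. }
  assert (HF1c : forall s, continuous F1 s) by (intros; eapply derive_cont, HF1).
  assert (HG1c : forall s, continuous G1 s) by (intros; eapply derive_cont, HG1).
  assert (HF1p : forall s, 0 < s -> 0 < F1 s).
  { intros s Hs. apply RInt_gt_0; [trivial| |intros; apply Hf1].
    intros x Hx. unfold f1. rewrite clamp_eq by lra. apply Hpos. lra. }
  assert (HG1p : forall s, 0 < s -> 0 < G1 s).
  { intros s Hs. apply RInt_gt_0; [trivial| |intros; apply HF1c].
    intros x Hx. apply HF1p. lra. }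
  rewrite (integral_diverges_iff p G G1) by (trivial; intros; apply HGG; lra).
  split.
  - intros [U [V HUV]].
    destruct (radial_reduction m p f U V HUV)
      as [u [w [dw [v [z [dz [_ [_ [Hv [_ [Hw [Hvz [Hz [Hw0 [Hz0 Heq]]]]]]]]]]]]]]].
    apply (profile_tail_diverges m p f1 F1 G1 v w dw z dz); trivial.
    split; [trivial|]. do 5 (split; [trivial|]). intros r Hr. split.
    + now apply Heq.
    + unfold f1. rewrite clamp_eq by apply Rabs_pos. now apply Heq.
  - intros Hdiv.
    assert (Ht := time_of_unbounded m p f1 F1 G1 Hp Hf0 HF1 HG1 HF10 HG10 HG1p Hdiv).
    destruct (step_fixpoint m p f1 F1 G1 Hp Hf1 Hmon Hf0 HF1 HG1 HF10 HG10 Ht)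
      as [v [Ha Hv]].
    apply (solution_of_profile m p f1 f v); trivial.
    intros s Hs. now apply clamp_eq.
Qed.

(** * Comparison with power solutions *)

Lemma powR_Rpower t a : 0 < t -> powR t a = Rpower t a.
Proof. intros Ht. unfold powR. now destruct (Rlt_dec 0 t). Qed.

Lemma powR_nonpos t a : t <= 0 -> powR t a = 0.
Proof. intros Ht. unfold powR. destruct (Rlt_dec 0 t); [lra | trivial]. Qed.

Lemma powR_nonneg t a : 0 <= powR t a.
Proof. unfold powR. destruct (Rlt_dec 0 t); [apply Rlt_le, Rpower_pos | lra]. Qed.

Lemma powR_le s t a : 0 <= a -> s <= t -> powR s a <= powR t a.
Proof.
  intros Ha Hst. destruct (Rlt_dec 0 s) as [Hs|Hs].
  - rewrite !powR_Rpower by lra. apply Rle_Rpower_l; lra.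
  - rewrite (powR_nonpos s) by lra. apply powR_nonneg.
Qed.

Lemma powR_scal c t a : 0 < c -> powR (c * t) a = Rpower c a * powR t a.
Proof.
  intros Hc. destruct (Rlt_dec 0 t) as [Ht|Ht].
  - rewrite !powR_Rpower by nra. now rewrite Rpower_mult_distr.
  - rewrite !powR_nonpos by nra. ring.
Qed.

Lemma is_derive_powR a x :
  0 < x -> is_derive (fun y => powR y a) x (a * Rpower x (a - 1)).
Proof.
  intros Hx. apply (is_derive_ext_loc (fun y => Rpower y a)); [|now apply is_derive_Rpower].
  exists (mkposreal x Hx). intros y Hy. change (Rabs (y - x) < x) in Hy.
  apply Rabs_def2 in Hy. rewrite powR_Rpower by lra. reflexivity.
Qed.

Lemma cont_powR a x : 0 < a -> continuous (fun y => powR y a) x.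
Proof.
  intros Ha. destruct (Rlt_dec 0 x) as [Hx|Hx].
  - eapply derive_cont. now apply is_derive_powR.
  - apply cont_eps. intros eps He. exists (Rpower eps (/ a)). split; [apply Rpower_pos|].
    intros y Hy. rewrite (powR_nonpos x) by lra.
    rewrite Rminus_0_r, Rabs_pos_eq by apply powR_nonneg.
    destruct (Rlt_dec 0 y) as [Hy0|Hy0]; [|now rewrite powR_nonpos by lra].
    rewrite powR_Rpower by trivial. rewrite Rabs_pos_eq in Hy by lra.
    replace eps with (Rpower (Rpower eps (/ a)) a).
    + apply Rlt_Rpower_l; lra.
    + rewrite Rpower_mult, Rinv_l, Rpower_1; lra.
Qed.

(** [Rle] gives subsolutions and [Rge] supersolutions; a solution satisfies it for every reflexive
    [rel]. *)
Definition system_ineq (rel : R -> R -> Prop) (m : nat) (p q : R)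
    (v w dw z dz : R -> R) : Prop :=
  (forall r, 0 <= r -> continuous v r /\ continuous w r /\ continuous z r) /\
  (forall r, 0 < r -> is_derive v r (z r) /\ is_derive w r (dw r) /\ is_derive z r (dz r)) /\
  rel (w 0) 0 /\ rel (z 0) 0 /\
  forall r, 0 < r -> rel (dw r + INR m / r * w r) (powR (v r) p) /\
    rel (dz r + INR m / r * z r) (powR (w r) q).

(** The factor passes once around the system: [t] for [v] becomes [t^p] for [w], then [t^(pq)] for
    [z], and integrating [z] returns it to [v]. The initial values cause no loss because
    [t^(pq) >= 1]. *)
Lemma comparison_step m p q v1 w1 dw1 z1 dz1 v2 w2 dw2 z2 dz2 t b :
  0 < p -> 0 < q ->
  system_ineq Rle m p q v1 w1 dw1 z1 dz1 -> system_ineq Rge m p q v2 w2 dw2 z2 dz2 ->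
  0 <= v2 0 -> v1 0 <= v2 0 -> 1 <= t ->
  (forall r, 0 <= r <= b -> v1 r <= t * v2 r) ->
  forall r, 0 <= r <= b ->
    w1 r <= Rpower t p * w2 r /\ v1 r <= Rpower t (p * q) * v2 r.
Proof.
  intros Hp Hq [Hc1 [Hd1 [Hw1 [Hz1 H1]]]] [Hc2 [Hd2 [Hw2 [Hz2 H2]]]] Hv2 Hv0 Ht Hle.
  assert (HT := Rpower_pos t p). assert (HTq := Rpower_pos t (p * q)).
  assert (HT1 : 1 <= Rpower t (p * q)).
  { rewrite <- (Rpower_O t) by lra. apply Rle_Rpower; nra. }
  assert (Hw : forall r, 0 <= r <= b -> w1 r <= Rpower t p * w2 r).
  { intros r Hr. apply Rminus_le_0.
    apply (weighted_nonneg m (fun s => Rpower t p * w2 s - w1 s)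
      (fun s => Rpower t p * dw2 s - dw1 s)).
    - lra.
    - intros x Hx. destruct (Hc1 x ltac:(lra)) as [_ [Hcx _]].
      destruct (Hc2 x ltac:(lra)) as [_ [Hcx2 _]]. cont; trivial.
    - nra.
    - intros x Hx. apply is_derive_Rminus; [apply is_derive_Rscal|];
        [apply Hd2 | apply Hd1]; lra.
    - intros x Hx. destruct (H1 x ltac:(lra)) as [Ha _]. destruct (H2 x ltac:(lra)) as [Hb _].
      assert (Hc := powR_le (v1 x) (t * v2 x) p ltac:(lra) (Hle x ltac:(lra))).
      rewrite powR_scal in Hc by lra.
      assert (Rpower t p * powR (v2 x) p <= Rpower t p * (dw2 x + INR m / x * w2 x))
        by (apply Rmult_le_compat_l; lra).
      lra. }
  assert (Hz : forall r, 0 <= r <= b -> z1 r <= Rpower t (p * q) * z2 r).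
  { intros r Hr. apply Rminus_le_0.
    apply (weighted_nonneg m (fun s => Rpower t (p * q) * z2 s - z1 s)
      (fun s => Rpower t (p * q) * dz2 s - dz1 s)).
    - lra.
    - intros x Hx. destruct (Hc1 x ltac:(lra)) as [_ [_ Hcx]].
      destruct (Hc2 x ltac:(lra)) as [_ [_ Hcx2]]. cont; trivial.
    - nra.
    - intros x Hx. apply is_derive_Rminus; [apply is_derive_Rscal|];
        [apply Hd2 | apply Hd1]; lra.
    - intros x Hx. destruct (H1 x ltac:(lra)) as [_ Ha]. destruct (H2 x ltac:(lra)) as [_ Hb].
      assert (Hc := powR_le (w1 x) (Rpower t p * w2 x) q ltac:(lra) (Hw x ltac:(lra))).
      rewrite powR_scal, Rpower_mult in Hc by trivial.
      assert (Rpower t (p * q) * powR (w2 x) q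
        <= Rpower t (p * q) * (dz2 x + INR m / x * z2 x)) by (apply Rmult_le_compat_l; lra).
      lra. }
  intros r Hr. split; [now apply Hw|].
  assert (H : Rpower t (p * q) * v2 0 - v1 0 <= Rpower t (p * q) * v2 r - v1 r).
  { apply (nondecr_of_derive (fun s => Rpower t (p * q) * v2 s - v1 s)
      (fun s => Rpower t (p * q) * z2 s - z1 s)).
    - lra.
    - intros x Hx. destruct (Hc1 x ltac:(lra)) as [Hcx _].
      destruct (Hc2 x ltac:(lra)) as [Hcx2 _]. cont; trivial.
    - intros x Hx. apply is_derive_Rminus; [apply is_derive_Rscal|];
        [apply Hd2 | apply Hd1]; lra.
    - intros x Hx. assert (Hzx := Hz x ltac:(lra)). lra. }
  nra.
Qed.

(* The system is homogeneous of degree [p q < 1], so a bound [v1 <= t v2]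
   improves to [v1 <= t^((p q)^n) v2] for all [n]. *)
Lemma comparison m p q v1 w1 dw1 z1 dz1 v2 w2 dw2 z2 dz2 c :
  0 < p -> 0 < q -> p * q < 1 ->
  system_ineq Rle m p q v1 w1 dw1 z1 dz1 -> system_ineq Rge m p q v2 w2 dw2 z2 dz2 ->
  v1 0 <= v2 0 -> 0 < c -> (forall r, 0 <= r -> c <= v2 r) ->
  forall r, 0 <= r -> v1 r <= v2 r /\ w1 r <= w2 r.
Proof.
  intros Hp Hq Hpq Hsub Hsup Hv0 Hc Hv2.
  assert (Hv20 : 0 <= v2 0) by (assert (H := Hv2 0 (Rle_refl 0)); lra).
  assert (Hv : forall b, 0 <= b -> v1 b <= v2 b).
  { intros b Hb.
    destruct (continuity_ab_maj v1 0 b Hb) as [x0 [Hmax _]].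
    { intros x Hx. apply continuity_pt_filterlim. apply (proj1 Hsub). lra. }
    (* A first admissible ratio on [[0, b]]: the maximum of [v1] over the lower bound of [v2]. *)
    set (t := Rmax 1 (v1 x0 / c)). assert (Ht : 1 <= t) by apply Rmax_l.
    assert (Hinit : forall r, 0 <= r <= b -> v1 r <= t * v2 r).
    { intros r Hr. apply Rle_trans with (v1 x0); [now apply Hmax|].
      assert (Ht2 : v1 x0 / c <= t) by apply Rmax_r.
      apply (Rmult_le_compat_r c) in Ht2; [|lra].
      replace (v1 x0 / c * c) with (v1 x0) in Ht2 by (field; lra).
      assert (H := Hv2 r ltac:(lra)). nra. }
    assert (Hn : forall n r, 0 <= r <= b -> v1 r <= Rpower t ((p * q) ^ n) * v2 r).
    { induction n as [|n IH].
      - simpl pow. intros r Hr. rewrite Rpower_1 by lra. now apply Hinit.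
      - intros r Hr.
        replace ((p * q) ^ S n) with ((p * q) ^ n * (p * q)) by (simpl; ring).
        rewrite <- Rpower_mult.
        apply (comparison_step m p q v1 w1 dw1 z1 dz1 v2 w2 dw2 z2 dz2 _ b); trivial.
        rewrite <- (Rpower_O t) by lra. apply Rle_Rpower; [trivial|]. apply pow_le. nra. }
    assert (Hlim : is_lim_seq (fun n => Rpower t ((p * q) ^ n) * v2 b) (v2 b)).
    { replace (Finite (v2 b)) with (Finite (Rpower t 0 * v2 b))
        by (rewrite Rpower_O by lra; f_equal; ring).
      apply (is_lim_seq_continuous (fun y => Rpower t y * v2 b) (fun n => (p * q) ^ n)).
      - apply continuity_pt_filterlim.
        apply (cont_mult (Rpower t) (fun _ => v2 b)); [|apply continuous_const].
        apply (cont_comp exp (fun y => y * ln t)); [cont | apply continuous_exp].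
      - apply is_lim_seq_geom. apply Rabs_def1; nra. }
    apply (is_lim_seq_le (fun _ => v1 b) (fun n => Rpower t ((p * q) ^ n) * v2 b) (v1 b) (v2 b)).
    - intros n. apply Hn. lra.
    - apply is_lim_seq_const.
    - exact Hlim. }
  intros r Hr. split; [now apply Hv|].
  replace (w2 r) with (Rpower 1 p * w2 r) by (rewrite Rpower_base_1; ring).
  apply (comparison_step m p q v1 w1 dw1 z1 dz1 v2 w2 dw2 z2 dz2 1 r); trivial; try lra.
  intros x Hx. rewrite Rmult_1_l. apply Hv. lra.
Qed.

(* Replacing [INR m / (r + s)] by the larger [INR m / r] turns the translate of
   the explicit power solution into a supersolution. *)
Lemma shifted_power m p q b d B D s r :
  0 < p -> 0 < q -> 0 < B -> 0 < D -> 0 < r + s ->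
  b = d * q + 2 -> d = b * p + 1 ->
  D * (d + INR m) = Rpower B p -> B * b * (b - 1 + INR m) = Rpower D q ->
  let v := fun x => B * powR (x + s) b in
  let w := fun x => D * powR (x + s) d in
  let z := fun x => B * b * powR (x + s) (b - 1) in
  let dw := fun x => D * (d * Rpower (x + s) (d - 1)) in
  let dz := fun x => B * b * ((b - 1) * Rpower (x + s) (b - 2)) in
  is_derive v r (z r) /\ is_derive w r (dw r) /\ is_derive z r (dz r) /\
  dw r + INR m / (r + s) * w r = powR (v r) p /\
  dz r + INR m / (r + s) * z r = powR (w r) q.
Proof.
  intros Hp Hq HB HD Hrs Hb Hd H1 H2 v w z dw dz.
  assert (Hshift : forall a c, is_derive (fun x => c * powR (x + s) a) r
    (c * (a * Rpower (r + s) (a - 1)))).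
  { intros a c. eapply is_derive_eq.
    - apply is_derive_Rscal. apply (is_derive_Rcomp (fun y => powR y a) (fun x => x + s)).
      + now apply is_derive_powR.
      + apply is_derive_Rplus; [apply is_derive_Rid | apply @is_derive_const].
    - unfold zero; simpl. ring. }
  assert (Hpow : forall c a e, 0 < c ->
    powR (c * powR (r + s) a) e = Rpower c e * Rpower (r + s) (a * e)).
  { intros c a e Hc. rewrite (powR_Rpower (r + s)), powR_scal by trivial.
    now rewrite powR_Rpower, Rpower_mult by apply Rpower_pos. }
  split; [|split; [|split; [|split]]].
  - eapply is_derive_eq; [apply Hshift|]. unfold z. rewrite powR_Rpower by trivial. ring.
  - apply Hshift.
  - eapply is_derive_eq; [apply Hshift|]. unfold dz. do 3 f_equal. ring.
  - unfold v, w, dw. rewrite Hpow, powR_Rpower, <- H1 by trivial.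
    rewrite <- (Rpower_succ (r + s) d) by trivial.
    replace (b * p) with (d - 1) by lra. field. lra.
  - unfold w, z, dz. rewrite Hpow, powR_Rpower, <- H2 by trivial.
    rewrite <- (Rpower_succ (r + s) (b - 1)) by trivial.
    replace (b - 1 - 1) with (b - 2) by ring. replace (d * q) with (b - 2) by lra.
    field. lra.
Qed.

(** The four identities state that [B r^b] and [D r^d] solve the system: two match the exponents,
    two the coefficients. The lower bound compares them with [v] and [w], the upper one compares [v]
    and [w] with their translates. *)
Lemma power_sandwich m p q b d B D v w dw z dz :
  0 < p -> 0 < q -> p * q < 1 -> 0 < B -> 0 < D -> 2 < b -> 1 < d ->
  b = d * q + 2 -> d = b * p + 1 ->
  D * (d + INR m) = Rpower B p -> B * b * (b - 1 + INR m) = Rpower D q ->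
  profile_ode m p (fun t => powR t q) v w dw z dz ->
  exists s, 0 < s /\ forall r, 0 < r ->
    (B * Rpower r b <= v r <= B * Rpower (r + s) b) /\
    (D * Rpower r d <= w r <= D * Rpower (r + s) d).
Proof.
  intros Hp Hq Hpq HB HD Hb2 Hd1 Hb Hd H1 H2 Hode.
  assert (Hm := pos_INR m).
  destruct (profile_monotone m p _ v w dw z dz Hp (fun s _ => powR_nonneg s q) Hode)
    as [_ [Hvm [Hwp _]]].
  destruct Hode as [Hv [Hw [Hvz [Hz [Hw0 [Hz0 Heq]]]]]].
  assert (Hsol : forall rel : R -> R -> Prop, (forall x, rel x x) ->
    system_ineq rel m p q v w dw z dz).
  { intros rel Hrel. split; [|split; [|split; [|split]]].
    - intros r _. split; [|split]; eapply derive_cont; auto.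
    - auto.
    - now rewrite Hw0.
    - now rewrite Hz0.
    - intros r Hr. destruct (Heq r Hr) as [-> ->].
      rewrite powR_Rpower by trivial. rewrite Rabs_pos_eq by (apply Hwp; lra). auto. }
  (* Chosen so that the translate starts exactly at [v 0], that is [B s^b = v 0]. *)
  set (s := Rpower (v 0 / B) (/ b)).
  assert (Hs : 0 < s) by apply Rpower_pos.
  assert (Hcont : forall a c s x, 0 < a -> continuous (fun y => c * powR (y + s) a) x).
  { intros a c s0 x Ha. apply cont_mult; [apply continuous_const|].
    apply (cont_comp (fun y => powR y a)); [cont | now apply cont_powR]. }
  assert (Hsh := fun s r => shifted_power m p q b d B D s r Hp Hq HB HD).
  assert (Hsub := Hsol Rge Rge_refl).
  assert (Hsup := Hsol Rle Rle_refl).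
  assert (Hlow : forall r, 0 <= r -> B * powR (r + 0) b <= v r /\ D * powR (r + 0) d <= w r).
  { apply (comparison m p q
      (fun x => B * powR (x + 0) b) (fun x => D * powR (x + 0) d)
      (fun x => D * (d * Rpower (x + 0) (d - 1))) (fun x => B * b * powR (x + 0) (b - 1))
      (fun x => B * b * ((b - 1) * Rpower (x + 0) (b - 2))) v w dw z dz (v 0)); trivial.
    - split; [|split; [|split; [|split]]].
      + intros r _. split; [|split]; apply Hcont; lra.
      + intros r Hr. destruct (Hsh 0 r ltac:(lra) Hb Hd H1 H2) as [? [? [? _]]]. auto.
      + rewrite powR_nonpos; lra.
      + rewrite powR_nonpos; lra.
      + intros r Hr. destruct (Hsh 0 r ltac:(lra) Hb Hd H1 H2) as [_ [_ [_ [Ha Hc]]]].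
        cbv beta zeta in Ha, Hc. rewrite Rplus_0_r in Ha, Hc |- *. lra.
    - rewrite powR_nonpos by lra. rewrite Rmult_0_r. now apply Rlt_le.
    - intros r Hr. apply Hvm. lra. }
  assert (Hhigh : forall r, 0 <= r -> v r <= B * powR (r + s) b /\ w r <= D * powR (r + s) d).
  { apply (comparison m p q v w dw z dz
      (fun x => B * powR (x + s) b) (fun x => D * powR (x + s) d)
      (fun x => D * (d * Rpower (x + s) (d - 1))) (fun x => B * b * powR (x + s) (b - 1))
      (fun x => B * b * ((b - 1) * Rpower (x + s) (b - 2))) (B * powR s b)); trivial.
    - split; [|split; [|split; [|split]]].
      + intros r _. split; [|split]; apply Hcont; lra.
      + intros r Hr. destruct (Hsh s r ltac:(lra) Hb Hd H1 H2) as [? [? [? _]]]. auto.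
      + apply Rle_ge, Rmult_le_pos; [lra | apply powR_nonneg].
      + apply Rle_ge, Rmult_le_pos; [nra | apply powR_nonneg].
      + intros r Hr. destruct (Hsh s r ltac:(lra) Hb Hd H1 H2) as [_ [_ [_ [Ha Hc]]]].
        cbv beta zeta in Ha, Hc.
        assert (Hrs : INR m / (r + s) <= INR m / r).
        { apply Rmult_le_compat_l; [trivial|]. apply Rinv_le_contravar; lra. }
        assert (Hx := powR_nonneg (r + s) d). assert (Hy := powR_nonneg (r + s) (b - 1)).
        rewrite <- Ha, <- Hc. split; apply Rle_ge, Rplus_le_compat_l, Rmult_le_compat_r; trivial.
        * apply Rmult_le_pos; lra.
        * apply Rmult_le_pos; nra.
    - rewrite Rplus_0_l, powR_Rpower by trivial. unfold s.
      rewrite Rpower_mult, Rinv_l, Rpower_1 by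
        (try lra; apply Rdiv_lt_0_compat; trivial).
      right. field. lra.
    - apply Rmult_lt_0_compat; [trivial|]. rewrite powR_Rpower by trivial. apply Rpower_pos.
    - intros r Hr. apply Rmult_le_compat_l; [lra|]. apply powR_le; lra. }
  exists s. split; [trivial|]. intros r Hr.
  destruct (Hlow r ltac:(lra)) as [Ha1 Ha2]. destruct (Hhigh r ltac:(lra)) as [Ha3 Ha4].
  rewrite Rplus_0_r in Ha1, Ha2. rewrite powR_Rpower in Ha1, Ha2, Ha3, Ha4 by lra. lra.
Qed.

(** * From two-sided bounds to limits, and the explicit constants *)

Lemma lim_ratio_of_sandwich N (w : Defs.Rn -> R) (g : R -> R) a A C s :
  0 < a -> 0 < A -> 0 <= C -> 0 < s -> (forall x, w x = g (normN N x)) ->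
  (forall r, 1 <= r -> A * Rpower r a - C <= g r <= A * Rpower (r + s) a + C) ->
  lim_at_infty_ratio N w a A.
Proof.
  intros Ha HA HC Hs Hw Hg eps He.
  assert (H1 : continuous (fun y => Rpower y a) 1).
  { eapply derive_cont. apply is_derive_Rpower. lra. }
  destruct (proj1 (cont_eps _ 1) H1 (eps / (2 * A)) ltac:(apply Rdiv_lt_0_compat; lra))
    as [dl [Hdl Hcl]].
  (* The three radii ensure, in order, that the bounds on [g] hold, that [(1 + s/r)^a] is close to
     1, and that [C / r^a < eps/2]. *)
  exists (Rmax 1 (Rmax (s / dl) (Rpower (2 * C / eps + 1) (/ a)))).
  intros x Hx. rewrite Hw. set (r := normN N x) in *.
  assert (Hr1 := Rle_lt_trans _ _ _ (Rmax_l _ _) Hx).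
  assert (Hx' := Rle_lt_trans _ _ _ (Rmax_r _ _) Hx).
  assert (Hr2 := Rle_lt_trans _ _ _ (Rmax_l _ _) Hx').
  assert (Hr3 := Rle_lt_trans _ _ _ (Rmax_r _ _) Hx').
  assert (HP := Rpower_pos r a).
  assert (Hk : 0 <= 2 * C / eps) by (apply Rdiv_le_0_compat; lra).
  assert (HPC : 2 * C / eps + 1 < Rpower r a).
  { replace (2 * C / eps + 1) with (Rpower (Rpower (2 * C / eps + 1) (/ a)) a)
      by (rewrite Rpower_mult, Rinv_l, Rpower_1; lra).
    apply Rlt_Rpower_l; [trivial|]. split; [apply Rpower_pos | trivial]. }
  assert (HCP : C / Rpower r a < eps / 2).
  { apply (Rmult_lt_reg_r (Rpower r a)); [trivial|].
    replace (C / Rpower r a * Rpower r a) with C by (field; lra).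
    replace C with (eps / 2 * (2 * C / eps)) at 1 by (field; lra). nra. }
  assert (Hsr : Rabs (1 + s / r - 1) < dl).
  { replace (1 + s / r - 1) with (s / r) by ring.
    rewrite Rabs_pos_eq by (apply Rdiv_le_0_compat; lra).
    apply (Rmult_lt_reg_r (r / dl)); [apply Rdiv_lt_0_compat; lra|].
    replace (s / r * (r / dl)) with (s / dl) by (field; lra).
    replace (dl * (r / dl)) with r by (field; lra). trivial. }
  assert (Hq := Hcl _ Hsr). rewrite Rpower_base_1 in Hq. apply Rabs_def2 in Hq.
  assert (Hrs : Rpower (r + s) a = Rpower (1 + s / r) a * Rpower r a).
  { rewrite Rpower_mult_distr; [f_equal; field; lra | | lra].
    assert (0 < s / r) by (apply Rdiv_lt_0_compat; lra). lra. }
  destruct (Hg r ltac:(lra)) as [Hl Hu]. rewrite Hrs in Hu.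
  assert (Hl' : A - C / Rpower r a <= g r / Rpower r a).
  { apply (Rmult_le_reg_r (Rpower r a)); [trivial|].
    replace (g r / Rpower r a * Rpower r a) with (g r) by (field; lra).
    replace ((A - C / Rpower r a) * Rpower r a) with (A * Rpower r a - C) by (field; lra).
    trivial. }
  assert (Hu' : g r / Rpower r a <= A * Rpower (1 + s / r) a + C / Rpower r a).
  { apply (Rmult_le_reg_r (Rpower r a)); [trivial|].
    replace (g r / Rpower r a * Rpower r a) with (g r) by (field; lra).
    replace ((A * Rpower (1 + s / r) a + C / Rpower r a) * Rpower r a)
      with (A * (Rpower (1 + s / r) a * Rpower r a) + C) by (field; lra).
    trivial. }
  assert (HAq : A * (Rpower (1 + s / r) a - 1) < eps / 2).
  { replace (eps / 2) with (A * (eps / (2 * A))) by (field; lra).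
    apply Rmult_lt_compat_l; lra. }
  apply Rabs_def1; lra.
Qed.

(** Integration starts at 1, because [Rpower] is not the power function at base 0; [C] collects
    [u 1] and the primitives at 1. *)
Lemma primitive_sandwich d D s (u w : R -> R) :
  0 < d -> 0 < D -> 0 < s -> (forall t, is_derive u t (w t)) ->
  (forall r, 0 < r -> D * Rpower r d <= w r <= D * Rpower (r + s) d) ->
  exists C, 0 <= C /\ forall r, 1 <= r ->
    D / (d + 1) * Rpower r (d + 1) - C <= u r <= D / (d + 1) * Rpower (r + s) (d + 1) + C.
Proof.
  intros Hd HD Hs Hu Hw. set (A := D / (d + 1)).
  assert (HA : 0 < A) by (apply Rdiv_lt_0_compat; lra).
  assert (Hpow : forall c x, 0 <= c -> 0 < x ->
    is_derive (fun y => A * Rpower (y + c) (d + 1)) x (D * Rpower (x + c) d)).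
  { intros c x Hc Hx. eapply is_derive_eq.
    - apply is_derive_Rscal, (is_derive_Rpower_comp (fun y => y + c)); [lra|].
      apply is_derive_Rplus; [apply is_derive_Rid | apply @is_derive_const].
    - unfold zero; simpl. replace (d + 1 - 1) with d by ring. unfold A. field. lra. }
  set (c1 := A * Rpower (1 + 0) (d + 1)). set (c2 := A * Rpower (1 + s) (d + 1)).
  exists (Rabs (u 1) + c1 + c2).
  assert (Hc1 : 0 < c1) by (apply Rmult_lt_0_compat; [trivial | apply Rpower_pos]).
  assert (Hc2 : 0 < c2) by (apply Rmult_lt_0_compat; [trivial | apply Rpower_pos]).
  assert (Hu0 := Rabs_pos (u 1)). split; [lra|]. intros r Hr.
  assert (Hu1 := Rle_abs (u 1)). assert (Hu2 := Rle_abs (- u 1)). rewrite Rabs_Ropp in Hu2.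
  assert (Hlow : u 1 - c1 <= u r - A * Rpower (r + 0) (d + 1)).
  { apply (nondecr_of_derive_all (fun y => u y - A * Rpower (y + 0) (d + 1))
      (fun y => w y - D * Rpower (y + 0) d)); [trivial| |].
    - intros x Hx. apply is_derive_Rminus; [trivial | apply Hpow; lra].
    - intros x Hx. rewrite Rplus_0_r. destruct (Hw x ltac:(lra)). lra. }
  assert (Hhigh : c2 - u 1 <= A * Rpower (r + s) (d + 1) - u r).
  { apply (nondecr_of_derive_all (fun y => A * Rpower (y + s) (d + 1) - u y)
      (fun y => D * Rpower (y + s) d - w y)); [trivial| |].
    - intros x Hx. apply is_derive_Rminus; [apply Hpow; lra | trivial].
    - intros x Hx. destruct (Hw x ltac:(lra)). lra. }
  rewrite Rplus_0_r in Hlow. lra.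
Qed.

Lemma ln_div_pos x y : 0 < x -> 0 < y -> ln (x / y) = ln x - ln y.
Proof.
  intros Hx Hy. unfold Rdiv. rewrite ln_mult, ln_Rinv; trivial.
  now apply Rinv_0_lt_compat.
Qed.

Ltac pos := repeat first
  [ assumption | apply Rpower_pos | apply Rdiv_lt_0_compat | apply Rmult_lt_0_compat ].

Ltac ln_expand :=
  repeat first [ rewrite ln_mult by pos | rewrite ln_div_pos by pos | rewrite ln_Rpower ].

(** Eliminating [D] from the coefficient identities gives [B^(pq-1) = b (b-1+m) (d+m)^q]. With
    [e = 1 - pq] the factors are [b = (2+q)/e], [b-1+m = K2/e] and [d+m = K1/e], which is the stated
    limit for [v]. Integrating [D r^d] gives the limit [D/(d+1)] for [u]. *)
Lemma asymptotics (m : nat) (p q : R) (u v : Defs.Rn -> R) :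
  0 < p -> 1 <= q -> p * q < 1 ->
  pos_radial_solution (S m) p (fun t => powR t q) u v ->
  lim_at_infty_ratio (S m) u ((2 + 2 * p - p * q) / (1 - p * q))
    (Rpower
      ((2 + q) * Rpower (INR (S m) * (1 - p * q) + p * (2 + q)) (1 / p)
         * (INR (S m) * (1 - p * q) + q * (2 * p + 1))
       / (Rpower (1 - p * q) ((2 * p + 2 - p * q) / p)
          * Rpower (2 + 2 * p - p * q) ((p * q - 1) / p)))
      (p / (p * q - 1))) /\
  lim_at_infty_ratio (S m) v ((q + 2) / (1 - p * q))
    (Rpower
      ((2 + q) * Rpower (INR (S m) * (1 - p * q) + p * (2 + q)) q
         * (INR (S m) * (1 - p * q) + q * (2 * p + 1))
       / Rpower (1 - p * q) (2 + q))
      (1 / (p * q - 1))).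
Proof.
  intros Hp Hq Hpq Hsol.
  destruct (radial_reduction m p _ u v Hsol)
    as [U [w [dw [V [z [dz [HU [HV [HVp [Hw [Hdw [Hz [Hdz [Hw0 [Hz0 Heq]]]]]]]]]]]]]]].
  assert (Hm := pos_INR m). rewrite !S_INR.
  set (e := 1 - p * q). assert (He : 0 < e) by (unfold e; lra).
  set (K1 := (INR m + 1) * e + p * (2 + q)).
  assert (HK1 : 0 < K1).
  { unfold K1. apply Rplus_lt_0_compat; apply Rmult_lt_0_compat; lra. }
  set (K2 := (INR m + 1) * e + q * (2 * p + 1)).
  assert (HK2 : 0 < K2).
  { unfold K2. apply Rplus_lt_0_compat; apply Rmult_lt_0_compat; lra. }
  set (h := 2 + 2 * p - p * q). assert (Hh : 0 < h) by (unfold h; lra).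
  assert (Hq2 : 0 < 2 + q) by lra.
  set (B := Rpower ((2 + q) * Rpower K1 q * K2 / Rpower e (2 + q)) (1 / (p * q - 1))).
  assert (HB : 0 < B) by apply Rpower_pos.
  set (b := (q + 2) / e). set (d := (1 + 2 * p) / e).
  set (D := Rpower B p / (K1 / e)). assert (HD : 0 < D) by (unfold D; pos).
  assert (Hb : b = d * q + 2) by (unfold b, d, e; field; lra).
  assert (Hd : d = b * p + 1) by (unfold b, d, e; field; lra).
  assert (Hb2 : 2 < b).
  { rewrite Hb. assert (0 < d) by (apply Rdiv_lt_0_compat; lra). nra. }
  assert (Hd1 : 1 < d) by (rewrite Hd; nra).
  assert (HlnB : ln B = / (- e) * (ln (2 + q) + q * ln K1 + ln K2 - (2 + q) * ln e)).
  { unfold B. ln_expand. unfold e. field. lra. }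
  assert (H1 : D * (d + INR m) = Rpower B p).
  { unfold D. replace (d + INR m) with (K1 / e) by (unfold d, K1, e; field; lra).
    field. split; lra. }
  (* After taking logarithms the identity is linear in the logarithms of [2+q], [K1], [K2] and [e],
     and [field] decides it. *)
  assert (H2 : B * b * (b - 1 + INR m) = Rpower D q).
  { replace (b - 1 + INR m) with (K2 / e) by (unfold b, K2, e; field; lra).
    unfold b. rewrite (Rplus_comm q 2). apply ln_inv; [pos | pos |].
    unfold D. ln_expand. rewrite HlnB.
    unfold e. field. lra. }
  destruct (power_sandwich m p q b d B D V w dw z dz) as [s [Hs Hsw]]; trivial; try lra.
  { split; [trivial|]. do 5 (split; [trivial|]). exact Heq. }
  split.
  - destruct (primitive_sandwich d D s U w) as [C [HC HUC]]; trivial; try lra.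
    { intros r Hr. now apply Hsw. }
    replace (h / e) with (d + 1) by (unfold h, d, e; field; lra).
    match goal with |- lim_at_infty_ratio _ _ _ ?A => replace A with (D / (d + 1)) end.
    + apply (lim_ratio_of_sandwich (S m) u U (d + 1) (D / (d + 1)) C s); trivial; try lra.
      apply Rdiv_lt_0_compat; lra.
    + replace (d + 1) with (h / e) by (unfold h, d, e; field; lra).
      apply ln_inv; [pos | pos |].
      unfold D. ln_expand. rewrite HlnB. unfold h, e. field. split; lra.
  - apply (lim_ratio_of_sandwich (S m) v V b B 0 s); trivial; try lra.
    intros r Hr. destruct (Hsw r ltac:(lra)) as [Hsr _]. lra.
Qed.

Theorem theorem2p6 (N : nat) (HN : (2 <= N)%nat) :
  (* part (i) *)
  (forall (p : R) (f F G : R -> R),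
     0 < p ->
     C1_nonneg f ->
     (forall s t, 0 <= s <= t -> f s <= f t) ->
     (forall t, 0 < t -> 0 < f t) ->
     (forall s, 0 <= s -> is_integral f 0 s (F s)) ->
     (forall s, 0 <= s -> is_integral F 0 s (G s)) ->
     ((exists u v, pos_radial_solution N p f u v) <->
      integral_diverges (fun s => Rpower (G s) (- (p / (2 * p + 1)))) 1))
  /\
  (* part (ii) *)
  (forall (p q : R),
     0 < p -> 1 <= q -> p < 1 -> p * q < 1 ->
     p * (q ^ 2 - 4) / (1 - p * q) <= 2 * (INR N - 1) ->
     forall u v, pos_radial_solution N p (fun t => powR t q) u v ->
       lim_at_infty_ratio N u ((2 + 2 * p - p * q) / (1 - p * q))
         (Rpower
            ((2 + q) * Rpower (INR N * (1 - p * q) + p * (2 + q)) (1 / p)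
               * (INR N * (1 - p * q) + q * (2 * p + 1))
             / (Rpower (1 - p * q) ((2 * p + 2 - p * q) / p)
                * Rpower (2 + 2 * p - p * q) ((p * q - 1) / p)))
            (p / (p * q - 1)))
       /\
       lim_at_infty_ratio N v ((q + 2) / (1 - p * q))
         (Rpower
            ((2 + q) * Rpower (INR N * (1 - p * q) + p * (2 + q)) q
               * (INR N * (1 - p * q) + q * (2 * p + 1))
             / Rpower (1 - p * q) (2 + q))
            (1 / (p * q - 1)))).
Proof.
  destruct N as [|m]; [lia|]. split.
  - intros p f F G. apply existence_iff.
  - intros p q Hp Hq _ Hpq _ u v. now apply asymptotics.
Qed.
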